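(* Let $(B,\omega)$ be a connected, closed contact manifold of dimension $2h+1$, and let $f\in\mathrm{Diff}^{+}(B)$ satisfy $f^{*}\omega=\omega$. Then there exists a contact pair $(\widetilde\omega,\eta)$ of type $(h,0)$ on the bundle $B_f$ over the circle. Moreover the pair can be chosen in such a way that every leaf $L$ of the characteristic foliation of $\eta$, equipped with the contact form induced on it by $\widetilde\omega$, is a contact embedding of $(B,\omega)$; that is, $L$ is the image of an embedding $B\to B_f$ which is a contactomorphism from $(B,\omega)$ onto $L$.
   Context: All objects are $C^\infty$. A contact manifold $(B,\omega)$ of dimension $2h+1$ is a manifold with a 1-form $\omega$ such that $\omega\wedge(d\omega)^h$ is nowhere zero. Closed means compact without boundary. $\mathrm{Diff}^{+}(B)$ is the group of orientation-preserving diffeomorphisms of $B$. For $f\in\mathrm{Diff}^{+}(B)$, $B_f$ denotes the fiber bundle over the circle with fiber $B$ obtained as the quotient of $B\times\,]-\epsilon,1+\epsilon[$ (with small $\epsilon>0$) by the equivalence relation identifying $(x,t)\in B\times\,]-\epsilon,\epsilon[$ with $(f(x),1+t)\in B\times\,]1-\epsilon,1+\epsilon[$. A contact pair of type $(h,k)$ (with $h,k\ge 0$ integers) on a $(2h+2k+2)$-dimensional manifold $M$ is a pair $(\alpha,\eta)$ of 1-forms on $M$ such that $(d\alpha)^{h+1}=0$, $(d\eta)^{k+1}=0$, and $\alpha\wedge(d\alpha)^{h}\wedge\eta\wedge(d\eta)^{k}$ is a volume form (nowhere zero). The characteristic foliation of $\eta$ is the foliation tangent to the (involutive) distribution $\{v:\eta(v)=0,\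 i(v)d\eta=0\}$; for a contact pair of type $(h,0)$ the form $\eta$ is closed, this distribution is $\ker\eta$, and $\alpha$ restricts to a contact form on each leaf. *)

(* Defs.v *)
From HB Require Import structures.
From mathcomp Require Import all_boot all_order all_algebra perm.
From mathcomp Require Import generic_quotient.
From mathcomp Require Import all_classical all_reals all_analysis.
From Stdlib Require Import Relation_Operators.

Set Implicit Arguments.
Unset Strict Implicit.
Unset Printing Implicit Defensive.

Import Order.TTheory GRing.Theory Num.Theory.
Import numFieldNormedType.Exports.

Local Open Scope classical_set_scope.
Local Open Scope ring_scope.
Local Open Scope quotient_scope.

Section smooth_functions.
Context {R : realType} {V W : normedModType R}.

(* Used for open U and finite-dimensional V only. *)
Fixpoint Ck_on (k : nat) (U : set V) (f : V -> W) : Prop :=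
  match k with
  | 0%N => forall x, U x -> {for x, continuous f}
  | k'.+1 => (forall x, U x -> differentiable f x) /\
             (forall v, Ck_on k' U (fun x => 'D_v f x))
  end.

Definition smooth_on (U : set V) (f : V -> W) : Prop := forall k, Ck_on k U f.

End smooth_functions.

Section exterior_algebra.
Context {R : realType} {n : nat}.

(* The k vector arguments are the rows of a k x n matrix. *)
Definition kform (k : nat) : Type := 'M[R]_(k, n) -> R.

Definition multilinear k (a : kform k) : Prop :=
  forall (A B C : 'M[R]_(k, n)) (i : 'I_k) (b c : R),
    row i A = b *: row i B + c *: row i C ->
    row' i B = row' i A -> row' i C = row' i A ->
    a A = b * a B + c * a C.

Definition alternating k (a : kform k) : Prop :=
  forall (A : 'M[R]_(k, n)) (i j : 'I_k), i != j -> row i A = row j A -> a A = 0.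

(* Normalized so that (a /\ b)(u, v) = a(u) b(v) - a(v) b(u) on 1-forms. *)
Definition wedge p q (a : kform p) (b : kform q) : kform (p + q) := fun v =>
  ((p`! * q`!)%N%:R)^-1 * \sum_(s : 'S_(p + q))
     (-1) ^+ s * (a (usubmx (row_perm s v)) * b (dsubmx (row_perm s v))).

Fixpoint wedge_pow p (a : kform p) (m : nat) : kform (m * p) :=
  match m with
  | 0%N => fun=> 1
  | m'.+1 => wedge a (@wedge_pow p a m')
  end.

(* (d a)_x(v_0, ..., v_k) = \sum_i (-1)^i D_{v_i}(a(v_0, .., ^v_i, .., v_k))(x) *)
Definition ext_deriv k (a : 'rV[R]_n -> kform k) (x : 'rV[R]_n) : kform k.+1 :=
  fun v => \sum_(i < k.+1)
    (-1) ^+ i * 'D_(row i v) (fun y => a y (row' i v) : R^o) x.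

End exterior_algebra.

Arguments kform : clear implicits.
Arguments wedge_pow {R n p} a m _.

(* [cmap] is meaningful on [cdom] only, and [cinv] on the image of [cdom]. *)
Record chart (R : realType) (n : nat) (M : topologicalType) := Chart {
  cdom : set M;
  cmap : M -> 'rV[R]_n;
  cinv : 'rV[R]_n -> M }.

Definition cimg R n M (c : chart R n M) : set 'rV[R]_n := cmap c @` cdom c.

Definition chart_axioms R n M (c : chart R n M) : Prop :=
  [/\ open (cdom c), open (cimg c),
      (forall p, cdom c p -> cinv c (cmap c p) = p),
      (forall p, cdom c p -> {for p, continuous (cmap c)}) &
      (forall x, cimg c x -> {for x, continuous (cinv c)})].

(* A space with an atlas {chart_at p | p}.  The choice of a preferred chart around
   each p is used to represent the tangent space T_p M by R^n. *)
Record charted (R : realType) (n : nat) := Charted {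
  carrier :> topologicalType;
  chart_at : carrier -> chart R n carrier }.

Arguments chart_at {R n c} _.

Section manifolds.
Context {R : realType}.

Definition smooth_manifold n (M : charted R n) : Prop :=
  [/\ hausdorff_space M, @second_countable M,
      (forall p : M, chart_axioms (chart_at p) /\ cdom (chart_at p) p) &
      (forall p q : M,
         smooth_on (cmap (chart_at p) @` (cdom (chart_at p) `&` cdom (chart_at q)))
                   (cmap (chart_at q) \o cinv (chart_at p)))].

Definition smooth_map m n (M : charted R m) (N : charted R n) (f : M -> N) : Prop :=
  continuous f /\
  forall (p : M) (q : N),
    smooth_on (cmap (chart_at p) @` (cdom (chart_at p) `&` f @^-1` cdom (chart_at q)))
              (cmap (chart_at q) \o f \o cinv (chart_at p)).

Section maps.
Context {m n : nat} {M : charted R m} {N : charted R n}.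
Implicit Type f : M -> N.

(* df_p : T_p M -> T_{f p} N, acting on row vectors on the right *)
Definition tangent_map f (p : M) : 'M[R]_(m, n) :=
  jacobian (cmap (chart_at (f p)) \o f \o cinv (chart_at p)) (cmap (chart_at p) p).

Definition immersion f : Prop :=
  smooth_map f /\ forall p, row_free (tangent_map f p).

Definition embedding f : Prop :=
  [/\ immersion f, injective f &
      forall U : set M, open U -> exists2 V : set N, open V & f @^-1` V = U].

Definition diffeomorphism f : Prop :=
  smooth_map f /\ exists2 g : N -> M, smooth_map g & cancel f g /\ cancel g f.

Definition pullback k f (a : N -> kform R n k) : M -> kform R m k :=
  fun p v => a (f p) (v *m tangent_map f p).

End maps.

Section forms.
Context {n : nat} {M : charted R n}.

(* expression of a in the coordinates of c *)
Definition in_chart k (c : chart R n M) (a : M -> kform R n k)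
    : 'rV[R]_n -> kform R n k :=
  fun x v => a (cinv c x) (v *m jacobian (cmap (chart_at (cinv c x)) \o cinv c) x).

Definition differential_form k (a : M -> kform R n k) : Prop :=
  (forall p, multilinear (a p) /\ alternating (a p)) /\
  (forall p v, smooth_on (cimg (chart_at p))
                 (fun x => in_chart (chart_at p) a x v : R^o)).

Definition ext_d k (a : M -> kform R n k) : M -> kform R n k.+1 :=
  fun p => ext_deriv (in_chart (chart_at p) a) (cmap (chart_at p) p).

Definition nowhere_zero k (a : M -> kform R n k) : Prop :=
  forall p, exists v, a p v != 0.

Definition contact_manifold (h : nat) (w : M -> kform R n 1) : Prop :=
  [/\ smooth_manifold M, n = (2 * h + 1)%N, differential_form w &
      nowhere_zero (fun p => wedge (w p) (wedge_pow (ext_d w p) h))].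

Definition contact_pair (h k : nat) (a e : M -> kform R n 1) : Prop :=
  [/\ smooth_manifold M /\ n = (2 * h + 2 * k + 2)%N,
      differential_form a /\ differential_form e,
      (forall p v, wedge_pow (ext_d a p) h.+1 v = 0),
      (forall p v, wedge_pow (ext_d e p) k.+1 v = 0) &
      nowhere_zero (fun p =>
        wedge (wedge (wedge (a p) (wedge_pow (ext_d a p) h)) (e p))
              (wedge_pow (ext_d e p) k))].

Definition characteristic_distribution (e : M -> kform R n 1) (p : M) : set 'rV[R]_n :=
  [set v | e p v = 0 /\ forall w : 'rV[R]_n, ext_d e p (col_mx v w) = 0].

(* On a connected orientable manifold the choice of nu (i.e. of an orientation)
   does not matter. *)
Definition orientation_preserving (f : M -> M) : Prop :=
  exists nu : M -> kform R n n,
    [/\ differential_form nu, nowhere_zero nu &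
        forall p v, 0 < nu p v -> 0 < pullback f nu p v].

Definition Diff_plus (f : M -> M) : Prop :=
  diffeomorphism f /\ orientation_preserving f.

(* An immersed submanifold is given by its inclusion map i : N -> M. *)
Definition connected_integral_manifold (D : forall p : M, set 'rV[R]_n)
    m (N : charted R m) (i : N -> M) : Prop :=
  [/\ smooth_manifold N, [set: N] !=set0 /\ connected [set: N],
      injective i, immersion i &
      forall x, range (fun u : 'rV[R]_m => u *m tangent_map i x) = D (i x)].

Definition submanifold_le m (N : charted R m) (i : N -> M)
    m' (N' : charted R m') (i' : N' -> M) : Prop :=
  exists2 g : N -> N', smooth_map g & i' \o g = i.

(* Maximality is with respect to the order on submanifolds given by smooth
   factorization of the inclusions. *)
Definition leaf (D : forall p : M, set 'rV[R]_n) m (N : charted R m) (i : N -> M)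
    : Prop :=
  connected_integral_manifold D i /\
  forall m' (N' : charted R m') (i' : N' -> M),
    connected_integral_manifold D i' -> submanifold_le i i' -> submanifold_le i' i.

End forms.

Definition contactomorphism m n (M : charted R m) (N : charted R n)
    (a : M -> kform R m 1) (b : N -> kform R n 1) (g : M -> N) : Prop :=
  diffeomorphism g /\ pullback g b = a.

End manifolds.

Section mapping_torus.
Context {R : realType} {n : nat} {B : charted R n} (f : B -> B) (eps : R).

Definition in_band : set (B * R) := [set p | - eps < p.2 < 1 + eps].
Definition band : Type := set_type in_band.
HB.instance Definition _ := Topological.on band.

Definition glue_step (p q : band) : Prop :=
  - eps < (val p).2 < eps /\ val q = (f (val p).1, 1 + (val p).2).

Definition torus_rel : rel band :=
  fun p q => `[< clos_refl_sym_trans band glue_step p q >].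

Lemma torus_rel_refl : reflexive torus_rel.
Proof. by move=> p; apply/asboolP; exact: rst_refl. Qed.

Lemma torus_rel_sym : symmetric torus_rel.
Proof. by move=> p q; apply/asboolP/asboolP; exact: rst_sym. Qed.

Lemma torus_rel_trans : transitive torus_rel.
Proof. by move=> q p r /asboolP pq /asboolP qr; apply/asboolP; exact: rst_trans qr. Qed.

Canonical torus_equiv := EquivRel torus_rel torus_rel_refl torus_rel_sym torus_rel_trans.

Definition torus_space : topologicalType :=
  quotient_topology {eq_quot torus_equiv}.

Definition torus_proj (p : band) : torus_space := \pi_(torus_space) p.

(* The projection is injective on (domain of a chart of B) x (interval of length
   at most 1), hence such sets, with coordinates (chart of B, t), give charts. *)
Definition torus_chart (r : band) : chart R (n + 1) torus_space :=
  let c := chart_at (val r).1 in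
  let W : set 'rV[R]_(n + 1) := [set y |
    [/\ cimg c (lsubmx y), - eps < rsubmx y 0 0 < 1 + eps &
        `|rsubmx y 0 0 - (val r).2| < 2^-1]] in
  let psi (y : 'rV[R]_(n + 1)) : torus_space :=
    torus_proj (insubd r (cinv c (lsubmx y), rsubmx y 0 0)) in
  Chart (psi @` W) ('pinv_(fun=> 0) W psi) psi.

Definition mapping_torus : charted R (n + 1) :=
  Charted (fun q : torus_space => torus_chart (repr q)).

End mapping_torus.

(* Main.v *)
From HB Require Import structures.
Require Import Defs.
From mathcomp Require Import all_boot all_order all_algebra.
From mathcomp Require Import all_fingroup generic_quotient lra.
From mathcomp Require Import all_classical all_reals all_analysis.
From Stdlib Require Import Relation_Operators.
Set Implicit Arguments.
Unset Strict Implicit.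
Unset Printing Implicit Defensive.
Import Order.TTheory GRing.Theory Num.Theory.
Import numFieldNormedType.Exports.
Local Open Scope classical_set_scope.
Local Open Scope ring_scope.

(** On B x R the form w + 0 and the form dt are invariant under the gluing map
    (x, t) |-> (f x, t + 1), because f preserves w; so they descend to forms
    torus_form and torus_dt on the mapping torus.  In a chart (chart of B, t) the
    first is the expression of w in the chart of B and the second is constant.
    Therefore d(torus_form) is pulled back from dw and d(torus_dt) = 0: the power
    (d torus_form)^(h+1) vanishes because it comes from an alternating form of degree
    2h + 2 on a space of dimension 2h + 1 (alternating_form_eq0), and the product of
    torus_form, (d torus_form)^h and torus_dt, evaluated on vectors v_1, .., v_n
    tangent to B and on the direction of t, is a nonzero multiple of
    (w /\ (dw)^h)(v_1, .., v_n) (wedge_block).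

    The tangent space at a point of the torus is represented by R^(n+1) through the
    chart of a chosen representative of the point, and two representatives of a point
    differ by one of three deck transformations, id, f and f^-1 (torus_relP).
    Consequently every change of charts of the torus is a change of charts of B
    composed with a deck transformation, times a translation of t
    (torus_transition), and all computations with tangent vectors reduce to the
    derivative of such a product (torus_transition_jacobian).

    The characteristic distribution of torus_dt is the kernel of dt.  Its integral
    manifolds include the fibers x |-> [x, t] of the torus (fiber_integral), which
    are embeddings pulling torus_form back to w.  Conversely, along a connected
    integral manifold i : L -> torus the coordinate t has zero derivative in every
    chart, hence is locally constant (near_integral_level), and by connectedness L
    lies over a single value of t mod 1 (integral_level); so i factors through a fiber
    by a smooth map (integral_factor).  When L is a leaf, its maximality gives a
    smooth factorization of the fiber through i as well.  The two factorizations are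
    inverse to each other, since i and the fiber are injective; this identifies
    B with L, and w with the form induced by torus_form. *)

(** * Calculus of C^k maps given by directional derivatives *)

Section calculus.
Context {R : realType}.
Implicit Types V W X : normedModType R.

Lemma near_eq_differentiable V W (f g : V -> W) x :
  {near x, f =1 g} -> differentiable f x -> differentiable g x.
Proof.
move=> fg /diff_locallyP[cdf fE].
have fgx : f x = g x by apply: nbhs_singleton fg.
have gE : g \o shift x = cst (g x) + 'd f x +o_ 0 id.
  have fgh : \forall h \near (0 : V), f (h + x) = g (h + x).
    by move: fg; rewrite (near_shift 0 x) /= subr0.
  apply/eqaddoP => e e0; move/eqaddoP/(_ e e0) : fE => fE.
  apply: (@filterS2 _ (nbhs (0 : V)) _ _ _ _ _ fE fgh) => h /= + E.
  by rewrite !fctE /= E fgx.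
apply/diff_locallyP; rewrite (diff_unique cdf gE); split=> //.
Qed.

Lemma derive_comp V W X (f : V -> W) (g : W -> X) x v :
  differentiable f x -> differentiable g (f x) ->
  'D_v (g \o f) x = 'D_('D_v f x) g (f x).
Proof.
by move=> df dg; rewrite !deriveE//; [rewrite diff_comp | exact: differentiable_comp].
Qed.

(** For the product rule in vector-valued form: scaling is registered as a bilinear
    map, so that its differential is given by the general theory. *)
Lemma scale_is_bilinear V :
  bilinear_for
    (GRing.Scale.Law.clone _ _ *:%R _) (GRing.Scale.Law.clone _ _ *:%R _)
    (@GRing.scale R V : R^o -> V -> V).
Proof.
split=> [u'|u] a x y /=.
- by rewrite scalerDl scalerA.
- by rewrite scalerDr !scalerA mulrC.
Qed.
HB.instance Definition _ V := bilinear_isBilinear.Build R R^o V V _ _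
  (@GRing.scale R V : R^o -> V -> V) (@scale_is_bilinear V).

Lemma differentiable_scale V W (a : V -> R^o) (b : V -> W) x :
  differentiable a x -> differentiable b x ->
  differentiable (fun y => a y *: b y) x.
Proof.
move=> da db.
have -> : (fun y => a y *: b y) = (fun p : R^o * W => p.1 *: p.2) \o (fun y => (a y, b y)) by [].
apply: differentiable_comp; first exact: differentiable_pair.
apply: (differentiable_bilin (f := (@GRing.scale R W : R^o -> W -> W))).
exact: scale_continuous.
Qed.

Lemma derive_scale V W (a : V -> R^o) (b : V -> W) x v :
  differentiable a x -> differentiable b x ->
  'D_v (fun y => a y *: b y) x = a x *: 'D_v b x + 'D_v a x *: b x.
Proof.
move=> da db; rewrite !deriveE//; last exact: differentiable_scale.
have -> : (fun y => a y *: b y) = (fun p : R^o * W => p.1 *: p.2) \o (fun y => (a y, b y)) by [].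
rewrite diff_comp; [|exact: differentiable_pair|]; last first.
  apply: (differentiable_bilin (f := (@GRing.scale R W : R^o -> W -> W))).
  exact: scale_continuous.
rewrite /= (diff_bilin (f := (@GRing.scale R W : R^o -> W -> W))); last first.
  exact: scale_continuous.
by rewrite diff_pair.
Qed.
End calculus.

Section Ck.
Context {R : realType}.
Implicit Types V W X : normedModType R.

(** As U is open, the derivatives at a point of U only depend on the values on U. *)
Lemma Ck_on_eq V W k (U : set V) (f g : V -> W) :
  open U -> (forall x, U x -> f x = g x) -> Ck_on k U f -> Ck_on k U g.
Proof.
move=> oU; have nearU x (f' g' : V -> W) : U x -> (forall x, U x -> f' x = g' x) ->
    {near x, f' =1 g'}.
  by move=> Ux E; apply: filterS (open_nbhs_nbhs (conj oU Ux)).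
elim: k f g => [|k IH] f g fg /= => [cf x Ux|[df Df]].
  move: (cf x Ux); rewrite /prop_for /continuous_at -(fg x Ux) => cfx.
  apply: cvg_trans cfx; apply: near_eq_cvg; exact: nearU.
split=> [x Ux|v]; first exact: near_eq_differentiable (nearU _ _ _ Ux fg) (df x Ux).
by apply: IH (Df v) => x Ux; apply: near_eq_derive; exact: nearU.
Qed.

Lemma Ck_onW V W k (U : set V) (f : V -> W) : Ck_on k.+1 U f -> Ck_on k U f.
Proof.
elim: k f => [|k IH] f [df Df].
  by move=> x Ux; apply: differentiable_continuous; exact: df.
by split=> // v; apply: IH; exact: Df.
Qed.

Lemma Ck_onS V W k (U U' : set V) (f : V -> W) : U `<=` U' -> Ck_on k U' f -> Ck_on k U f.
Proof.
move=> UU'; elim: k f => [|k IH] f /=; first by move=> cf x /UU'; exact: cf.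
by move=> [df Df]; split=> [x /UU'|v]; [exact: df | exact: IH].
Qed.

Lemma Ck_on_cst V W k (U : set V) (c : W) : Ck_on k U (cst c).
Proof.
elim: k c => [|k IH] c; first by move=> x _; exact: cst_continuous.
split=> [x _|v]; first exact: differentiable_cst.
have -> : (fun x => 'D_v (cst c) x) = cst 0 by apply/funext => x; rewrite derive_cst.
exact: IH.
Qed.

Lemma Ck_onD V W k (U : set V) (f g : V -> W) :
  open U -> Ck_on k U f -> Ck_on k U g -> Ck_on k U (fun x => f x + g x).
Proof.
move=> oU; elim: k f g => [|k IH] f g.
  by move=> cf cg x Ux; exact: (continuousD (cf x Ux) (cg x Ux)).
move=> [df Df] [dg Dg]; split=> [x Ux|v].
  exact: (differentiableD (df x Ux) (dg x Ux)).
apply: (@Ck_on_eq _ _ _ _ (fun x => 'D_v f x + 'D_v g x)) => //; last exact: (IH _ _ (Df v) (Dg v)).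
by move=> x Ux; rewrite -deriveD; [|exact/diff_derivable/df|exact/diff_derivable/dg].
Qed.

Lemma Ck_on_sum V W k (U : set V) (I : finType) (f : I -> V -> W) :
  open U -> (forall i, Ck_on k U (f i)) -> Ck_on k U (fun x => \sum_i f i x).
Proof.
move=> oU Hf; have -> : (fun x => \sum_i f i x) = \sum_i f i.
  by apply/funext => x; rewrite fct_sumE.
elim/big_rec: _ => [|i g _ Hg]; first exact: Ck_on_cst.
exact: Ck_onD.
Qed.

Lemma Ck_on_scale V W k (U : set V) (a : V -> R^o) (b : V -> W) :
  open U -> Ck_on k U a -> Ck_on k U b -> Ck_on k U (fun x => a x *: b x).
Proof.
move=> oU; elim: k a b => [|k IH] a b.
  by move=> ca cb x Ux; exact: (cvgZ (ca x Ux) (cb x Ux)).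
move=> [da Da] [db Db]; split=> [x Ux|v].
  by apply: differentiable_scale; [exact: da | exact: db].
apply: (@Ck_on_eq _ _ _ _ (fun x => a x *: 'D_v b x + 'D_v a x *: b x)) => //.
  by move=> x Ux; rewrite derive_scale//; [exact: da | exact: db].
by apply: Ck_onD => //; apply: IH => //; (exact: Da || exact: Db || (apply: Ck_onW; split)).
Qed.

Lemma derive_linear V W (L : {linear V -> W}) x v : continuous L -> 'D_v L x = L v.
Proof. by move=> cL; rewrite deriveE ?diff_lin//; exact: linear_differentiable. Qed.

Lemma Ck_on_linear V W k (U : set V) (L : {linear V -> W}) : continuous L -> Ck_on k U L.
Proof.
move=> cL; case: k => [|k]; first by move=> x _; exact: cL.
split=> [x _|v]; first exact: linear_differentiable.
have -> : (fun x => 'D_v L x) = cst (L v) by apply/funext => x; rewrite derive_linear.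
exact: Ck_on_cst.
Qed.

Lemma Ck_on_linear_comp V W X k (U : set V) (f : V -> W) (L : {linear W -> X}) :
  open U -> continuous L -> Ck_on k U f -> Ck_on k U (L \o f).
Proof.
move=> oU cL; elim: k f => [|k IH] f.
  by move=> cf x Ux; apply: continuous_comp; [exact: cf | exact: cL].
move=> [df Df]; split=> [x Ux|v].
  by apply: differentiable_comp; [exact: df | exact: linear_differentiable].
apply: (@Ck_on_eq _ _ _ _ (L \o (fun x => 'D_v f x))) => //; last exact: (IH _ (Df v)).
move=> x Ux /=; rewrite derive_comp ?derive_linear//; first exact: df.
exact: linear_differentiable.
Qed.

Definition coordL m (j : 'I_m) : 'rV[R]_m -> R^o := fun N => N ord0 j.
Lemma coordL_linear m j : linear (@coordL m j).
Proof. by move=> a u v; rewrite /coordL !mxE. Qed.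
HB.instance Definition _ m j := GRing.isLinear.Build R 'rV[R]_m R^o _ (@coordL m j) (@coordL_linear m j).

(** The chain rule gives a derivative of g in a direction that varies with the point,
    whereas Ck_on only speaks of fixed directions: the varying direction is expanded
    on the canonical basis. *)
Lemma derive_rV_expand m W (g : 'rV[R]_m -> W) y u : differentiable g y ->
  'D_u g y = \sum_j u 0 j *: 'D_(delta_mx 0 j) g y.
Proof.
move=> dg; rewrite deriveE// {1}(row_sum_delta u) linear_sum.
by apply: eq_bigr => j _; rewrite linearZ deriveE.
Qed.

(** By induction on k: a derivative of g \o f is a sum of products of a coordinate of a
    derivative of f with the composition of f and a derivative of g. *)
Lemma Ck_on_comp V W m k (U : set V) (U' : set 'rV[R]_m) (f : V -> 'rV[R]_m)
    (g : 'rV[R]_m -> W) :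
  open U -> (forall x, U x -> U' (f x)) -> Ck_on k U f -> Ck_on k U' g -> Ck_on k U (g \o f).
Proof.
move=> oU UU'; elim: k W g => [|k IH] W g.
  by move=> cf cg x Ux; apply: continuous_comp; [exact: cf | exact/cg/UU'].
move=> Cf [dg Dg]; have [df Df] := Cf; split=> [x Ux|v].
  by apply: differentiable_comp; [exact: df | exact/dg/UU'].
apply: (@Ck_on_eq _ _ _ _ (fun x => \sum_j coordL j ('D_v f x) *: ('D_(delta_mx 0 j) g \o f) x)) => //.
  move=> x Ux; rewrite (derive_comp v (df x Ux) (dg _ (UU' _ Ux))).
  by rewrite derive_rV_expand//; exact/dg/UU'.
apply: Ck_on_sum => // j; apply: Ck_on_scale => //.
  have cL : continuous (@coordL m j) by exact: coord_continuous.
  exact: (Ck_on_linear_comp (L := @coordL m j) oU cL (Df v)).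
exact: (IH _ _ (Ck_onW Cf) (Dg _)).
Qed.

(** Smoothness as a local property, which is what can be transported along equality
    of germs when charts are changed. *)
Definition smooth_near V W (f : V -> W) (x : V) :=
  exists2 U : set V, open U /\ U x & smooth_on U f.

Lemma smooth_onP V W (U : set V) (f : V -> W) : open U ->
  smooth_on U f <-> forall x, U x -> smooth_near f x.
Proof.
move=> oU; split=> [sf x Ux|sf k]; first by exists U.
have loc : forall x, U x -> exists2 N : set V, open N /\ N x & Ck_on k N f.
  by move=> x /sf[N Ox sO]; exists N.
elim: k f loc {sf} => [|k IH] f loc /=.
  by move=> x /loc[N [oO Ox]] /(_ x Ox).
split=> [x /loc[N [oO Ox]] [+ _]|v]; first by apply.
by apply: IH => x /loc[N oOx [_ /(_ v)]]; exists N.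
Qed.

Lemma smooth_near_eq V W (f g : V -> W) x :
  {near x, f =1 g} -> smooth_near f x -> smooth_near g x.
Proof.
rewrite /prop_near1 nbhsE => -[N [oO Ox] OE] [U [oU Ux] sU].
exists (U `&` N); first by split; [exact: openI | ].
move=> k; apply: (@Ck_on_eq _ _ _ _ f) => [|y []|]; [exact: openI| |].
  by move=> _ /OE.
exact: Ck_onS (sU k).
Qed.

Lemma smooth_near_continuous V W (f : V -> W) x : smooth_near f x -> {for x, continuous f}.
Proof. by move=> [U [oU Ux] /(_ 0%N)]; apply. Qed.

Lemma smooth_near_differentiable V W (f : V -> W) x : smooth_near f x -> differentiable f x.
Proof. by move=> [U [oU Ux] /(_ 1%N) [+ _]]; apply. Qed.

Lemma smooth_near_comp V W m (f : V -> 'rV[R]_m) (g : 'rV[R]_m -> W) x :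
  smooth_near f x -> smooth_near g (f x) -> smooth_near (g \o f) x.
Proof.
move=> sf; have cf := smooth_near_continuous sf; case: sf => U [oU Ux] sU [U' [oU' Ux'] sU'].
have : nbhs x (U `&` f @^-1` U').
  apply: filterI; first exact: open_nbhs_nbhs.
  by apply: cf; exact: open_nbhs_nbhs.
rewrite nbhsE => -[N [oO Ox] OU]; exists N => // k.
apply: (@Ck_on_comp _ _ _ _ N U') => //; first by move=> y /OU[].
by apply: Ck_onS (sU k) => y /OU[].
Qed.

Lemma smooth_near_linear V W (L : {linear V -> W}) x : continuous L -> smooth_near L x.
Proof. by move=> cL; exists setT; [split=> //; exact: openT | move=> k; exact: Ck_on_linear]. Qed.

Lemma smooth_near_cst V W (c : W) (x : V) : smooth_near (fun=> c) x.
Proof. by exists setT; [split=> //; exact: openT | move=> k; exact: Ck_on_cst]. Qed.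

Lemma smooth_nearD V W (f g : V -> W) x :
  smooth_near f x -> smooth_near g x -> smooth_near (fun y => f y + g y) x.
Proof.
move=> [U [oU Ux] sU] [U' [oU' Ux'] sU']; have oI := openI oU oU'.
exists (U `&` U'); first by split.
by move=> k; apply: Ck_onD => //; [apply: Ck_onS (sU k) | apply: Ck_onS (sU' k)] => y [].
Qed.

Lemma smooth_near_linear_comp V W X (f : V -> W) (L : {linear W -> X}) x :
  continuous L -> smooth_near f x -> smooth_near (L \o f) x.
Proof.
move=> cL [U [oU Ux] sU]; exists U => // k; exact: Ck_on_linear_comp.
Qed.

End Ck.

(** * Charts and smooth maps between manifolds *)
Section jacobian.
Context {R : realType}.

Lemma mulrV_inj m n (A B : 'M[R]_(m, n)) :
  (forall v : 'rV_m, v *m A = v *m B) -> A = B.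
Proof. by move=> E; apply/row_matrixP => i; rewrite rowE E -rowE. Qed.

Lemma jacobian_comp m n p (f : 'rV[R]_m -> 'rV[R]_n) (g : 'rV[R]_n -> 'rV[R]_p) x :
  differentiable f x -> differentiable g (f x) ->
  jacobian (g \o f) x = jacobian f x *m jacobian g (f x).
Proof.
move=> df dg; have dgf := differentiable_comp df dg.
apply: mulrV_inj => v; rewrite mulmxA.
rewrite -(deriveEjacobian v df) -(deriveEjacobian _ dg) -(deriveEjacobian _ dgf).
exact: derive_comp.
Qed.

Lemma near_eq_jacobian m n (f g : 'rV[R]_m -> 'rV[R]_n) x :
  {near x, f =1 g} -> differentiable f x -> jacobian f x = jacobian g x.
Proof.
move=> fg df; have dg := near_eq_differentiable fg df; apply: mulrV_inj => v.
exact: etrans (esym (deriveEjacobian v df)) (etrans (near_eq_derive v fg) (deriveEjacobian v dg)).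
Qed.

Lemma jacobian_id m (x : 'rV[R]_m) : jacobian id x = 1%:M.
Proof.
have did : differentiable (@id 'rV[R]_m) x by [].
by apply: mulrV_inj => v; rewrite -(deriveEjacobian v did) derive_id mulmx1.
Qed.
End jacobian.

Section charts.
Context {R : realType} {n : nat} {M : topologicalType} (c : chart R n M).
Hypothesis ax : chart_axioms c.

Lemma cmapK x : cdom c x -> cinv c (cmap c x) = x.
Proof. by case: ax => _ _ + _ _; apply. Qed.

Lemma cimg_cmap x : cdom c x -> cimg c (cmap c x).
Proof. by move=> cx; exists x. Qed.

Lemma cdom_cinv y : cimg c y -> cdom c (cinv c y).
Proof. by move=> [x cx <-]; rewrite cmapK. Qed.

Lemma cinvK y : cimg c y -> cmap c (cinv c y) = y.
Proof. by move=> [x cx <-]; rewrite cmapK. Qed.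

Lemma near_cdom x : cdom c x -> nbhs x (cdom c).
Proof. by case: ax => oc _ _ _ _ cx; exact: open_nbhs_nbhs. Qed.

Lemma cmap_continuous x : cdom c x -> {for x, continuous (cmap c)}.
Proof. by case: ax => _ _ _ + _; apply. Qed.

Lemma cinv_continuous y : cimg c y -> {for y, continuous (cinv c)}.
Proof. by case: ax => _ _ _ _; apply. Qed.

Lemma near_cimg y : cimg c y -> nbhs y (cimg c).
Proof. by case: ax => _ oc _ _ _ cy; exact: open_nbhs_nbhs. Qed.

Lemma near_cinv x (A : set M) : cdom c x -> nbhs x A ->
  \forall y \near cmap c x, cimg c y /\ A (cinv c y).
Proof.
move=> cx Ax; have iy := cimg_cmap cx.
apply: filterI; first exact: near_cimg.
by apply: (cinv_continuous iy); rewrite /= cmapK.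
Qed.

Lemma near_cmap x (A : set 'rV[R]_n) : cdom c x -> nbhs (cmap c x) A ->
  \forall y \near x, cdom c y /\ A (cmap c y).
Proof.
by move=> cx Ax; apply: filterI; [exact: near_cdom | exact: (cmap_continuous cx)].
Qed.

Lemma chart_image_open (A : set M) : open A -> open (cmap c @` (cdom c `&` A)).
Proof.
move=> oA; rewrite openE => _ [x [cx Ax] <-].
have : nbhs x A by exact: open_nbhs_nbhs.
move=> /(near_cinv cx); apply: filterS => y [iy Ay].
by exists (cinv c y); [split=> //; exact: cdom_cinv | exact: cinvK].
Qed.
End charts.

Section manifold_maps.
Context {R : realType}.

Section transition.
Context {n : nat} {M : charted R n}.
Hypothesis sM : smooth_manifold M.

Lemma chart_at_axioms (p : M) : chart_axioms (chart_at p).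
Proof. by case: sM => _ _ /(_ p)[]. Qed.

Lemma cdom_chart_at (p : M) : cdom (chart_at p) p.
Proof. by case: sM => _ _ /(_ p)[]. Qed.

Lemma transition_near (p q x : M) :
  cdom (chart_at p) x -> cdom (chart_at q) x ->
  smooth_near (cmap (chart_at q) \o cinv (chart_at p)) (cmap (chart_at p) x).
Proof.
move=> px qx; case: sM => _ _ _ /(_ p q); rewrite smooth_onP.
  by apply; exists x.
by apply: (chart_image_open (chart_at_axioms p)); have [] := chart_at_axioms q.
Qed.

End transition.

Context {m n : nat} {M : charted R m} {N : charted R n}.
Hypotheses (sM : smooth_manifold M) (sN : smooth_manifold N).
Implicit Type f : M -> N.

Lemma smooth_map_near f (p x : M) (q : N) : smooth_map f ->
  cdom (chart_at p) x -> cdom (chart_at q) (f x) ->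
  smooth_near (cmap (chart_at q) \o f \o cinv (chart_at p)) (cmap (chart_at p) x).
Proof.
move=> [cf sf] px qx; move: (sf p q); rewrite smooth_onP.
  by apply; exists x.
apply: (chart_image_open (chart_at_axioms sM p)).
apply: open_comp; first by move=> *; exact: cf.
by have [] := chart_at_axioms sN q.
Qed.

(** The expression of f in the charts p, q is, as a germ, its expression in p', q'
    conjugated by the transition maps. *)
Lemma near_change_charts f (p p' x : M) (q q' : N) : {for x, continuous f} ->
  cdom (chart_at p) x -> cdom (chart_at q) (f x) ->
  cdom (chart_at p') x -> cdom (chart_at q') (f x) ->
  {near cmap (chart_at p) x,
    (cmap (chart_at q) \o cinv (chart_at q')) \o
    (cmap (chart_at q') \o f \o cinv (chart_at p')) \o
    (cmap (chart_at p') \o cinv (chart_at p))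
    =1 cmap (chart_at q) \o f \o cinv (chart_at p)}.
Proof.
move=> cf px qx p'x q'x.
have : nbhs x (cdom (chart_at p') `&` f @^-1` cdom (chart_at q')).
  apply: filterI; first exact: (near_cdom (chart_at_axioms sM p')).
  by apply: cf; exact: (near_cdom (chart_at_axioms sN q')).
move=> /(near_cinv (chart_at_axioms sM p) px); apply: filterS => y [iy [p'y q'y]] /=.
by rewrite !cmapK//; exact: chart_at_axioms.
Qed.

Lemma smooth_near_change_charts f (p p' x : M) (q q' : N) : {for x, continuous f} ->
  cdom (chart_at p) x -> cdom (chart_at q) (f x) ->
  cdom (chart_at p') x -> cdom (chart_at q') (f x) ->
  smooth_near (cmap (chart_at q') \o f \o cinv (chart_at p')) (cmap (chart_at p') x) ->
  smooth_near (cmap (chart_at q) \o f \o cinv (chart_at p)) (cmap (chart_at p) x).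
Proof.
move=> cf px qx p'x q'x sf; apply: smooth_near_eq.
  exact: (near_change_charts cf px qx p'x q'x).
have Ep : (cmap (chart_at p') \o cinv (chart_at p)) (cmap (chart_at p) x) = cmap (chart_at p') x.
  by rewrite /= cmapK//; exact: chart_at_axioms.
apply: smooth_near_comp; first exact: transition_near.
rewrite Ep; apply: smooth_near_comp => //=.
rewrite (cmapK (chart_at_axioms sM p'))//; exact: transition_near.
Qed.

(** It suffices to look at one pair of charts around each point and its image. *)
Lemma smooth_mapP f : continuous f ->
  (forall x, smooth_near (cmap (chart_at (f x)) \o f \o cinv (chart_at x)) (cmap (chart_at x) x)) ->
  smooth_map f.
Proof.
move=> cf sf; split=> // p q; rewrite smooth_onP; last first.
  apply: (chart_image_open (chart_at_axioms sM p)).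
  apply: open_comp; first by move=> *; exact: cf.
  by have [] := chart_at_axioms sN q.
move=> _ [x [px qx] <-].
by apply: (@smooth_near_change_charts f p x x q (f x)) => //;
  [exact: cf | exact: cdom_chart_at | exact: cdom_chart_at].
Qed.

Lemma smooth_map_near_at f (x : M) : smooth_map f ->
  smooth_near (cmap (chart_at (f x)) \o f \o cinv (chart_at x)) (cmap (chart_at x) x).
Proof. by move=> sf; apply: smooth_map_near => //; exact: cdom_chart_at. Qed.

(** tangent_map is computed in the preferred charts; this reads it in any other chart
    of the source, as needed to compare in_chart and pullback. *)
Lemma jacobian_tangent_map f (p x : M) : smooth_map f -> cdom (chart_at p) x ->
  jacobian (cmap (chart_at (f x)) \o f \o cinv (chart_at p)) (cmap (chart_at p) x)
  = jacobian (cmap (chart_at x) \o cinv (chart_at p)) (cmap (chart_at p) x)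
    *m tangent_map f x.
Proof.
move=> sf px; have dx := cdom_chart_at sM x; have dfx := cdom_chart_at sN (f x).
have Ep : (cmap (chart_at x) \o cinv (chart_at p)) (cmap (chart_at p) x) = cmap (chart_at x) x.
  by rewrite /= cmapK//; exact: chart_at_axioms.
rewrite /tangent_map -[in RHS]Ep -jacobian_comp.
- apply: near_eq_jacobian; last first.
    by apply/smooth_near_differentiable/smooth_map_near.
  have := near_cinv (chart_at_axioms sM p) px (near_cdom (chart_at_axioms sM x) dx).
  by apply: filterS => y [iy xy] /=; rewrite (cmapK (chart_at_axioms sM x)).
- exact/smooth_near_differentiable/transition_near.
- by rewrite Ep; exact/smooth_near_differentiable/smooth_map_near_at.
Qed.

End manifold_maps.

Section category.
Context {R : realType}.
Context {m n l : nat} {M : charted R m} {N : charted R n} {P : charted R l}.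
Hypotheses (sM : smooth_manifold M) (sN : smooth_manifold N) (sP : smooth_manifold P).

Lemma smooth_map_continuous (f : M -> N) : smooth_map f -> continuous f.
Proof. by case. Qed.

Lemma smooth_map_id : smooth_map (@id M).
Proof.
apply: smooth_mapP => // [x|x]; first exact: cvg_id.
by apply: transition_near => //; exact: cdom_chart_at.
Qed.

Lemma near_comp_chart (f : M -> N) (g : N -> P) x : smooth_map f ->
  {near cmap (chart_at x) x,
    (cmap (chart_at (g (f x))) \o g \o cinv (chart_at (f x))) \o
    (cmap (chart_at (f x)) \o f \o cinv (chart_at x))
    =1 cmap (chart_at (g (f x))) \o (g \o f) \o cinv (chart_at x)}.
Proof.
move=> [cf _].
have : nbhs x (f @^-1` cdom (chart_at (f x))).
  by apply: cf; apply: near_cdom (cdom_chart_at sN _); exact: chart_at_axioms.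
move=> /(near_cinv (chart_at_axioms sM x) (cdom_chart_at sM x)).
by apply: filterS => y [iy fy] /=; rewrite (cmapK (chart_at_axioms sN _)).
Qed.

Lemma rep_at (f : M -> N) x :
  (cmap (chart_at (f x)) \o f \o cinv (chart_at x)) (cmap (chart_at x) x)
  = cmap (chart_at (f x)) (f x).
Proof. by rewrite /= (cmapK (chart_at_axioms sM x))//; exact: cdom_chart_at. Qed.

Lemma tangent_map_comp (f : M -> N) (g : N -> P) x :
  smooth_map f -> smooth_map g ->
  tangent_map (g \o f) x = tangent_map f x *m tangent_map g (f x).
Proof.
move=> sf sg; rewrite /tangent_map -(rep_at f) -jacobian_comp.
- apply/esym/near_eq_jacobian; first exact: near_comp_chart.
  apply: differentiable_comp.
    exact/smooth_near_differentiable/smooth_map_near_at.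
  by rewrite rep_at; exact/smooth_near_differentiable/smooth_map_near_at.
- exact/smooth_near_differentiable/smooth_map_near_at.
- by rewrite rep_at; exact/smooth_near_differentiable/smooth_map_near_at.
Qed.

Lemma tangent_map_id x : tangent_map (@id M) x = 1%:M.
Proof.
rewrite -(jacobian_id (cmap (chart_at x) x)); apply: near_eq_jacobian.
  have := near_cimg (chart_at_axioms sM x) (cimg_cmap (cdom_chart_at sM x)).
  by apply: filterS => y iy /=; rewrite (cinvK (chart_at_axioms sM x)).
by apply/smooth_near_differentiable/transition_near => //; exact: cdom_chart_at.
Qed.

End category.

(** * Functions with zero derivative *)
Section locally_constant.
Context {R : realType}.

(** The mean value theorem on the segments issued from y0 inside a ball. *)
Lemma near_derive0_cst (V : normedModType R) (u : V -> R^o) y0 :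
  (\forall y \near y0, differentiable u y /\ forall v, 'D_v u y = 0) ->
  \forall y \near y0, u y = u y0.
Proof.
move=> /nbhs_ballP[e /= e0 ue]; apply/nbhs_ballP; exists e => //= y yb.
pose c (s : R) : V := s *: (y - y0) + y0.
have cb s : 0 <= s <= 1 -> ball y0 e (c s).
  move=> /andP[s0 s1]; move: yb; rewrite -ball_normE /= /ball_ /c /= => yb.
  rewrite opprD addrCA subrr addr0 normrN normrZ ger0_norm//.
  rewrite distrC in yb; apply: le_lt_trans yb.
  by rewrite ler_piMl.
have dc (s : R) : is_derive s (1 : R) c (y - y0).
  have [dl dlE] : is_diff s ( *:%R^~ (y - y0) : R -> V) ( *:%R^~ (y - y0)).
    exact: is_diff_scalel.
  have dl1 : is_derive s (1 : R) ( *:%R^~ (y - y0) : R -> V) (y - y0).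
    by apply: DeriveDef; [exact: diff_derivable | rewrite deriveE// dlE scale1r].
  have := is_deriveD dl1 (is_derive_cst y0 s (1 : R)).
  by rewrite addr0.
have duc (s : R) : 0 <= s <= 1 -> is_derive s (1 : R) (u \o c) 0.
  move=> /cb /ue[du Du].
  have dcs : differentiable c s by apply/derivable1_diffP.
  have duc : differentiable (u \o c) s by exact: differentiable_comp.
  apply: DeriveDef; first exact: diff_derivable.
  by rewrite (derive_comp _ dcs du) Du.
have ider (s : R) : s \in `]0, 1[ -> is_derive s (1 : R) (u \o c) 0.
  by rewrite in_itv /= => /andP[/ltW s0 /ltW s1]; apply: duc; rewrite s0 s1.
have cont : {within `[0, 1], continuous (u \o c)}.
  apply: continuous_in_subspaceT => s /set_mem /=; rewrite in_itv /= => /duc ds.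
  apply: differentiable_continuous; apply/derivable1_diffP.
  exact: ex_derive.
have [s _] := MVT_segment ler01 ider cont.
rewrite mul0r => /eqP; rewrite subr_eq0 /= /c scale1r scale0r add0r subrK.
by move=> /eqP.
Qed.
End locally_constant.

Section change_target.
Context {R : realType} {m n : nat} {M : charted R m} {N : charted R n}.
Hypotheses (sM : smooth_manifold M) (sN : smooth_manifold N).

(** Counterpart of jacobian_tangent_map for the target: the Jacobian of f in charts p, q
    is corrected by the transition to the preferred chart at f x. *)
Lemma jacobian_target_chart (f : M -> N) (p x : M) (q : N) : smooth_map f ->
  cdom (chart_at p) x -> cdom (chart_at q) (f x) ->
  jacobian (cmap (chart_at q) \o f \o cinv (chart_at p)) (cmap (chart_at p) x) *m
    jacobian (cmap (chart_at (f x)) \o cinv (chart_at q)) (cmap (chart_at q) (f x)) =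
  jacobian (cmap (chart_at x) \o cinv (chart_at p)) (cmap (chart_at p) x) *m
    tangent_map f x.
Proof.
move=> sf px qx; have H := jacobian_tangent_map sM sN sf px.
apply: etrans H.
have d1 := smooth_near_differentiable (smooth_map_near sM sN sf px qx).
have fxx := cdom_chart_at sN (f x).
have d2 := smooth_near_differentiable (transition_near sN qx fxx).
have E : cmap (chart_at q) (f x) =
    (cmap (chart_at q) \o f \o cinv (chart_at p)) (cmap (chart_at p) x).
  by rewrite /= (cmapK (chart_at_axioms sM p)).
rewrite E in d2 *; apply: etrans (esym (jacobian_comp d1 d2)) _.
apply: near_eq_jacobian; last exact: differentiable_comp.
have : nbhs x (f @^-1` cdom (chart_at q)).
  by apply: (smooth_map_continuous sf); exact: (near_cdom (chart_at_axioms sN q)).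
move=> /(near_cinv (chart_at_axioms sM p) px); apply: filterS => y [iy qy].
exact: (congr1 (cmap (chart_at (f x))) (cmapK (chart_at_axioms sN q) qy)).
Qed.
End change_target.

(** * Exterior algebra *)
Section exterior.
Context {R : realType}.

(** Antisymmetry under permutations of the arguments, rather than vanishing on equal
    arguments: a wedge product has it whatever its factors are. *)
Definition antisymmetric_form n k (a : kform R n k) : Prop :=
  forall (s : 'S_k) v, a (row_perm s v) = (-1) ^+ s * a v.

(** Reindexing the sum over the symmetric group that defines the product. *)
Lemma wedge_antisymmetric n p q (a : kform R n p) (b : kform R n q) :
  antisymmetric_form (wedge a b).
Proof.
move=> t v; rewrite /wedge mulrCA; congr (_ * _); rewrite mulr_sumr.
rewrite (reindex_inj (mulIg t^-1)%g) /=; apply: eq_bigr => s _.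
by rewrite -row_permM mulgKV odd_permM odd_permV signr_addb -mulrA mulrCA.
Qed.

Lemma antisymmetric_alternating n k (a : kform R n k) :
  antisymmetric_form a -> Defs.alternating a.
Proof.
move=> asa A i j ij rij; have := asa (tperm i j) A.
have -> : row_perm (tperm i j) A = A.
  apply/row_matrixP => l; apply/rowP => x; rewrite !mxE.
  have /rowP/(_ x) := rij; rewrite !mxE => Eij.
  by case: tpermP => [->|->|].
by rewrite odd_tperm ij expr1 mulN1r => /eqP; rewrite -addr_eq0 -mulr2n mulrn_eq0 => /eqP.
Qed.

Lemma wedge_mulmx n n' p q (a : kform R n p) (b : kform R n q) (L : 'M[R]_(n', n)) v :
  wedge (fun u => a (u *m L)) (fun u => b (u *m L)) v = wedge a b (v *m L).
Proof.
rewrite /wedge; congr (_ * _); apply: eq_bigr => s _.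
have rpE : row_perm s (v *m L) = row_perm s v *m L by rewrite !row_permE mulmxA.
by rewrite rpE -mul_usub_mx -mul_dsub_mx.
Qed.

Lemma wedge_pow_mulmx n n' p (a : kform R n p) (L : 'M[R]_(n', n)) m v :
  wedge_pow (fun u => a (u *m L)) m v = wedge_pow a m (v *m L).
Proof.
elim: m v => [//|m IH] v.
rewrite -[RHS]wedge_mulmx /=; congr (wedge _ _ _); exact/funext.
Qed.

Lemma row'_eqP n k (A B : 'M[R]_(k, n)) i :
  (forall j, j != i -> row j A = row j B) <-> row' i A = row' i B.
Proof.
split=> [E|E j ji].
  apply/row_matrixP => j; apply/rowP => x; rewrite !mxE.
  have ji : lift i j != i by rewrite eq_sym neq_lift.
  by have /rowP/(_ x) := E _ ji; rewrite !mxE.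
have [l jE] : exists l, j = lift i l.
  by rewrite eq_sym in ji; have [l -> _] := unlift_some ji; exists l.
by apply/rowP => x; have /matrixP/(_ l x) := E; rewrite !mxE jE.
Qed.

Lemma multilinear_row n k (a : kform R n k) (A B C : 'M[R]_(k, n)) i b c :
  multilinear a -> row i A = b *: row i B + c *: row i C ->
  (forall j, j != i -> row j B = row j A) -> (forall j, j != i -> row j C = row j A) ->
  a A = b * a B + c * a C.
Proof. by move=> ma rA /row'_eqP BA /row'_eqP CA; exact: ma rA BA CA. Qed.

(** In the term of index s the row i of the arguments feeds exactly one of the two
    factors, according to the block in which s^-1 i falls. *)
Lemma wedge_multilinear n p q (a : kform R n p) (b : kform R n q) :
  multilinear a -> multilinear b -> multilinear (wedge a b).
Proof.
move=> ma mb A B C i x y rA /row'_eqP BA /row'_eqP CA.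
rewrite /wedge !(mulrCA _ (_^-1)) -mulrDr; congr (_ * _).
rewrite !mulr_sumr -big_split; apply: eq_bigr => s _ /=.
rewrite !(mulrCA _ ((-1) ^+ s)) -mulrDr; congr (_ * _).
have rowE' X (j : 'I_(p + q)) : row j (row_perm s X) = row (s j) X.
  by apply/rowP => l; rewrite !mxE.
have rowU X j : row j (usubmx (row_perm s X)) = row (s (lshift q j)) X.
  by rewrite -rowE'; apply/rowP => l; rewrite !mxE.
have rowD X j : row j (dsubmx (row_perm s X)) = row (s (rshift p j)) X.
  by rewrite -rowE'; apply/rowP => l; rewrite !mxE.
have [j ij] : exists j, s j = i by exists (s^-1%g i); rewrite permKV.
move: (splitK j); case: (fintype.split j) => k /= kj.
  have dE X : (forall j, j != i -> row j X = row j A) ->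
      dsubmx (row_perm s X) = dsubmx (row_perm s A).
    move=> XA; apply/row_matrixP => l; rewrite !rowD; apply: XA.
    by rewrite -ij -kj (inj_eq perm_inj) eq_rlshift.
  rewrite (dE B)// (dE C)// !mulrA -mulrDl; congr (_ * _).
  apply: (multilinear_row (i := k)) => //; rewrite ?rowU ?kj ?ij// => l lk; rewrite !rowU;
    [apply: BA | apply: CA]; by rewrite -ij -kj (inj_eq perm_inj) eq_lshift.
have uE X : (forall j, j != i -> row j X = row j A) ->
    usubmx (row_perm s X) = usubmx (row_perm s A).
  move=> XA; apply/row_matrixP => l; rewrite !rowU; apply: XA.
  by rewrite -ij -kj (inj_eq perm_inj) eq_lrshift.
rewrite (uE B)// (uE C)// !(mulrCA _ (a _)) -mulrDr; congr (_ * _).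
apply: (multilinear_row (i := k)) => //; rewrite ?rowD ?kj ?ij// => l lk; rewrite !rowD;
  [apply: BA | apply: CA]; by rewrite -ij -kj (inj_eq perm_inj) eq_rshift.
Qed.

Lemma wedge_pow_multilinear n p (a : kform R n p) m :
  multilinear a -> multilinear (wedge_pow a m).
Proof.
move=> ma; elim: m => [|m IH]; last exact: wedge_multilinear.
by move=> A B C [].
Qed.

(** More vectors than the dimension are linearly dependent, say by a combination u with
    u i != 0.  Replacing the i-th vector by the combination, which is 0, gives 0; expanded
    by linearity, it gives u i times the value of a, all other terms having two equal
    arguments. *)
Lemma alternating_form_eq0 n k (a : kform R n k) v :
  multilinear a -> Defs.alternating a -> (n < k)%N -> a v = 0.
Proof.
move=> ma aa nk.
have [u u0 uv] : exists2 u : 'rV_k, u != 0 & u *m v = 0.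
  have : kermx v != 0.
    by rewrite -mxrank_eq0 mxrank_ker subn_eq0 -ltnNge (leq_ltn_trans (rank_leq_col v)).
  by move=> /rowV0Pn[u /sub_kermxP uv u0]; exists u.
have [i ui] : exists i, u 0 i != 0 by apply/rV0Pn.
pose v_ (x : 'rV[R]_n)  : 'M[R]_(k, n) := \matrix_(j, l) (if j == i then x 0 l else v j l).
have rowi x : row i (v_ x) = x by apply/rowP => l; rewrite !mxE eqxx.
have rowj x j : j != i -> row j (v_ x) = row j v.
  by move=> /negbTE ji; apply/rowP => l; rewrite !mxE ji.
have lin b c x y : a (v_ (b *: x + c *: y)) = b * a (v_ x) + c * a (v_ y).
  by apply: (multilinear_row (i := i)) => [//||j ji|j ji]; rewrite ?rowi ?rowj.
have vE : v_ (row i v) = v.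
  by apply/matrixP => j l; rewrite !mxE; case: eqP => // ->.
have a0 : a (v_ 0) = 0.
  by have := lin 0 0 0 0; rewrite !scale0r addr0 !mul0r addr0.
have : a (v_ (u *m v)) = 0 by rewrite uv.
rewrite mulmx_sum_row (bigD1 i)//= -[X in _ + X]scale1r lin vE mul1r.
rewrite [X in _ + X](_ : _ = 0) ?addr0.
  by move=> /eqP; rewrite mulf_eq0 (negbTE ui) => /eqP.
elim/big_ind: _ => [//|x y xE yE|j ji].
  by have := lin 1 1 x y; rewrite !scale1r xE yE !mulr0 addr0.
have := lin (u 0 j) 0 (row j v) 0; rewrite scale0r addr0 mul0r addr0 => ->.
by rewrite (aa (v_ (row j v)) i j) ?mulr0 1?eq_sym// rowi rowj.
Qed.

(** The equality of signatures is read off the determinant of the block diagonal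
    permutation matrix. *)
Lemma perm_fix_rshift p q (s : 'S_(p + q)) : (forall j, s (rshift p j) = rshift p j) ->
  exists2 s' : 'S_p, forall i, s (lshift q i) = lshift q (s' i) & (s' = s :> bool).
Proof.
move=> sr.
have ex i : exists j, s (lshift q i) == lshift q j.
  move: (splitK (s (lshift q i))); case: (fintype.split _) => j /= E; first by exists j; rewrite E.
  by have := sr j; rewrite [in RHS]E => /perm_inj/eqP; rewrite eq_rlshift.
pose g i := xchoose (ex i).
have gE i : s (lshift q i) = lshift q (g i) by apply/eqP/(xchooseP (ex i)).
have gI : injective g.
  by move=> i j /(congr1 (lshift q)); rewrite -!gE => /perm_inj/lshift_inj.
exists (perm gI) => [i|]; first by rewrite permE gE.
have sE : perm_mx s = block_mx (perm_mx (perm gI)) 0 0 1%:M :> 'M[R]_(p + q).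
  apply/matrixP => i j; move: (splitK i) (splitK j).
  case: (fintype.split i) => i' /= <-; case: (fintype.split j) => j' /= <-.
  - by rewrite block_mxEul !mxE gE permE eq_lshift.
  - by rewrite block_mxEur !mxE gE eq_lrshift.
  - by rewrite block_mxEdl !mxE sr eq_rlshift.
  - by rewrite block_mxEdr !mxE sr eq_rshift.
have := congr1 determinant sE; rewrite det_ublock det1 mulr1 !det_perm.
by move=> /signr_inj ->.
Qed.

(** The case of interest is b = dt on R^n x R.  By the hypothesis on b, only the
    permutations fixing the second block pointwise contribute to the product, and each
    of them contributes a v because a is antisymmetric; c is their number divided by
    p! q!. *)
Lemma wedge_block n n' p q (a : kform R n p) (b : kform R (n + n') q)
    (v : 'M[R]_(p, n)) (w : 'M[R]_(q, n')) : antisymmetric_form a ->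
  (forall s : 'S_(p + q), b (dsubmx (row_perm s (block_mx v 0 0 w))) =
     ([forall j, s (rshift p j) == rshift p j])%:R) ->
  exists2 c : R, c != 0 &
    wedge (fun u => a (lsubmx u)) b (block_mx v 0 0 w) = c * a v.
Proof.
move=> asa bE; pose P (s : 'S_(p + q)) := [forall j, s (rshift p j) == rshift p j].
exists (((p`! * q`!)%N%:R)^-1 * #|P|%:R).
  rewrite mulf_neq0 ?invr_eq0 ?pnatr_eq0 -?lt0n ?muln_gt0 ?fact_gt0//.
  by apply/card_gt0P; exists 1%g; apply/forallP => j; rewrite perm1.
rewrite /wedge -mulrA; congr (_ * _).
rewrite (bigID P)/= [X in _ + X]big1 ?addr0; last first.
  by move=> s /negbTE sP; rewrite bE -/(P s) sP !mulr0.
rewrite -sum1_card natr_sum mulr_suml; apply: eq_bigr => s sP.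
rewrite bE -/(P s) sP mulr1 mul1r.
have [j|s' s'E ss'] := @perm_fix_rshift p q s; first exact/eqP/(forallP sP).
rewrite (_ : lsubmx _ = row_perm s' v) ?asa -?ss' ?signrMK//.
apply/matrixP => i j; rewrite !mxE s'E.
by rewrite (unsplitK (inl _)) !mxE (unsplitK (inl _)).
Qed.

(** The last factor of the volume form of a contact pair of type (h, 0) is an empty
    power, whose degree is written 0 * 2; hence a variable degree q equal to 0. *)
Lemma wedge_scalar n p q (a : kform R n p) (v : 'M[R]_(p, n)) (w : 'M[R]_(q, n)) :
  q = 0%N -> antisymmetric_form a ->
  exists2 c : R, c != 0 & wedge a (fun _ : 'M[R]_(q, n) => 1) (col_mx v w) = c * a v.
Proof.
move=> q0 asa; subst q; exists (((p`! * 0`!)%N%:R)^-1 * #|{: 'S_(p + 0)}|%:R).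
  rewrite mulf_neq0 ?invr_eq0 ?pnatr_eq0 -?lt0n ?muln_gt0 ?fact_gt0//.
  by apply/card_gt0P; exists 1%g.
rewrite /wedge -mulrA; congr (_ * _).
rewrite -sum1_card natr_sum mulr_suml; apply: eq_bigr => s _.
have [[]//|s' s'E ss'] := @perm_fix_rshift p 0 s.
rewrite mulr1 mul1r (_ : usubmx _ = row_perm s' v) ?asa -?ss' ?signrMK//.
by apply/matrixP => i j; rewrite !mxE s'E (unsplitK (inl _)).
Qed.

Lemma multilinear_mulmx n n' k (a : kform R n k) (L : 'M[R]_(n', n)) :
  multilinear a -> multilinear (fun v => a (v *m L)).
Proof.
move=> ma A C D i b c rA /row'_eqP CA /row'_eqP DA.
have rE X j : row j (X *m L) = row j X *m L by rewrite row_mul.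
apply: (multilinear_row (i := i)) => // [|j ji|j ji]; rewrite !rE.
- by rewrite rA mulmxDl -!scalemxAl.
- by rewrite CA.
- by rewrite DA.
Qed.

(** In the i-th term the i-th argument is the direction of differentiation, in which
    the derivative is linear; in the others it is an argument of a. *)
Lemma ext_deriv_multilinear n k (a : 'rV[R]_n -> kform R n k) x :
  (forall y, multilinear (a y)) ->
  (forall v, differentiable (fun y => a y v : R^o) x) ->
  multilinear (ext_deriv a x).
Proof.
move=> ma da A C D i b c rA /row'_eqP CA /row'_eqP DA.
rewrite /ext_deriv !mulr_sumr -big_split; apply: eq_bigr => j _ /=.
rewrite !(mulrCA _ ((-1) ^+ j)) -mulrDr; congr (_ * _).
have [ji|ji] := eqVneq j i.
  have -> : row' j C = row' j A by apply/row'_eqP; rewrite ji.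
  have -> : row' j D = row' j A by apply/row'_eqP; rewrite ji.
  by rewrite !deriveE// ji rA linearD !linearZ.
rewrite CA// DA//.
have [l lE] : exists l, i = lift j l by have [l -> _] := unlift_some ji; exists l.
have rE X m : row m (row' j X) = row (lift j m) X by apply/rowP => ?; rewrite !mxE.
have aE y : a y (row' j A) = b * a y (row' j C) + c * a y (row' j D).
  apply: (multilinear_row (i := l)) => // [|m ml|m ml]; rewrite !rE.
  - by rewrite -lE.
  - by rewrite CA// lE (inj_eq lift_inj).
  - by rewrite DA// lE (inj_eq lift_inj).
have -> : (fun y => a y (row' j A) : R^o) =
    (b *: (fun y => a y (row' j C) : R^o)) + (c *: (fun y => a y (row' j D) : R^o)).
  by apply/funext => y; rewrite aE.
rewrite deriveD ?deriveZ//; try (exact: diff_derivable).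
  by apply/derivableZ/diff_derivable.
by apply/derivableZ/diff_derivable.
Qed.

End exterior.

(** * Topology of the mapping torus *)
Section torus.
Context {R : realType} {n : nat} {B : charted R n}.
Variables (f g : B -> B) (eps : R).

(** The transformations of B x R that can relate two points of the band: powers of the
    gluing map other than these three move t by at least 2 > 1 + 2 eps. *)
Definition deck (phi : B -> B) (c : R) : Prop :=
  [\/ phi = id /\ c = 0, phi = f /\ c = 1 | phi = g /\ c = -1].

Hypotheses (sB : smooth_manifold B) (sf : smooth_map f) (sg : smooth_map g).
Hypotheses (fK : cancel f g) (gK : cancel g f) (epsP : 0 < eps < 2^-1).

Notation band := (@Defs.band R n B eps).
Notation torus := (mapping_torus f eps).
Notation proj := (@torus_proj R n B f eps).

Lemma deck_id : deck id 0. Proof. exact: Or31. Qed.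

Lemma deck_inv phi c : deck phi c ->
  exists psi, [/\ deck psi (- c), cancel phi psi & cancel psi phi].
Proof.
case=> -[-> ->].
- by exists id; rewrite oppr0; split=> //; exact: deck_id.
- by exists g; split=> //; exact: Or33.
- by exists f; split=> //; rewrite opprK; exact: Or32.
Qed.

Lemma deck_smooth phi c : deck phi c -> smooth_map phi.
Proof. by case=> -[-> _] //; exact: smooth_map_id. Qed.

Lemma bandP (p : band) : - eps < (val p).2 < 1 + eps.
Proof. by have /set_mem := valP p. Qed.

(** Composing f, or f^-1, with itself is excluded by the bounds on t, as eps < 1/2. *)
Lemma deck_trans phi c psi d (t : R) : deck phi c -> deck psi d ->
  - eps < t < 1 + eps -> - eps < t + c < 1 + eps -> - eps < t + c + d < 1 + eps ->
  deck (psi \o phi) (c + d).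
Proof.
have fgE : f \o g = id by apply/funext.
have gfE : g \o f = id by apply/funext.
move=> [] [-> ->] [] [-> ->] Ht Htc Htcd; rewrite ?addr0 ?add0r ?subrr ?addNr ?fgE ?gfE;
  solve [exact: Or31 | exact: Or32 | exact: Or33 | exfalso; move: epsP; lra].
Qed.

Lemma torus_relP (p q : band) : torus_rel f p q <->
  exists phi c, deck phi c /\ val q = (phi (val p).1, (val p).2 + c).
Proof.
split=> [/asboolP|].
  elim=> {p q} [p q [tp ->]|p|p q _ [phi [c [dc E]]]|p q r _ [phi [c [dc E]]] _ [psi [d [dd E']]]].
  - by exists f, 1; split; [exact: Or32 | rewrite addrC].
  - by exists id, 0; split; [exact: Or31 | rewrite addr0; case: (val p)].
  - have [psi [dpsi phiK psiK]] := deck_inv dc; exists psi, (- c); split=> //.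
    by rewrite E /= phiK addrK; case: (val p).
  - exists (psi \o phi), (c + d).
    have := bandP p; have := bandP q; have := bandP r; rewrite E' E /= addrA => Hr Hq Hp.
    by split; [exact: deck_trans Hp Hq Hr | ].
move=> [phi [c [dc E]]]; apply/asboolP; have := bandP q; have := bandP p.
case: dc E => -[-> ->] E; rewrite E /= => Hp Hq.
- have -> : p = q by apply: val_inj; rewrite E addr0; case: (val p).
  exact: rst_refl.
- by apply: rst_step; split; [lra | rewrite E addrC].
- apply/rst_sym/rst_step; split; first by rewrite E /=; lra.
  by rewrite E /= gK addrCA subrr addr0; case: (val p).
Qed.

Lemma projP (p q : band) : proj p = proj q <-> torus_rel f p q.
Proof. by split=> [/eqmodP|/eqmodP]. Qed.

Lemma torus_proj_continuous : continuous (proj : band -> torus).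
Proof. exact: pi_continuous. Qed.

Lemma open_torusP (U : set torus) : open U <-> open ((proj : band -> torus) @^-1` U).
Proof. by []. Qed.

Lemma open_bandP (U : set band) : open U <-> exists2 U' : set (B * R), open U' & val @^-1` U' = U.
Proof. by []. Qed.

Lemma reprP (q : torus) : proj (repr q) = q.
Proof. exact: reprK. Qed.

Lemma open_in_band : open (@in_band R n B eps).
Proof.
have -> : @in_band R n B eps = snd @^-1` [set t : R | - eps < t < 1 + eps] by [].
apply: open_comp => [p _|]; first exact: cvg_snd.
have -> : [set t : R | - eps < t < 1 + eps] = [set` `] - eps, 1 + eps[ ].
  by apply/seteqP; split=> t /=; rewrite in_itv.
exact: interval_open.
Qed.

Definition glue_shift (phi : B -> B) (c : R) (p : B * R) : B * R := (phi p.1, p.2 + c).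

Lemma glue_shift_continuous phi c : deck phi c -> continuous (glue_shift phi c).
Proof.
move=> dc p.
have c1 : {for p, continuous (fun p : B * R => phi p.1)}.
  apply: continuous_comp; first exact: cvg_fst.
  exact: (smooth_map_continuous (deck_smooth dc)).
have c2 : {for p, continuous (fun p : B * R => p.2 + c)}.
  by apply: cvgD; [exact: cvg_snd | exact: cvg_cst].
exact: cvg_pair c1 c2.
Qed.

(** The saturation of U is the union of the preimages of U under the deck
    transformations, which are continuous. *)
Lemma torus_proj_open (U : set band) : open U -> open ((proj : band -> torus) @` U).
Proof.
move=> /open_bandP[U' oU' UE]; apply/open_torusP/open_bandP.
exists (\bigcup_(phi in [set pc | deck pc.1 pc.2])
          (glue_shift phi.1 phi.2 @^-1` (U' `&` @in_band R n B eps))).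
  apply: bigcup_open => -[phi c] /= dc; apply: open_comp.
    by move=> *; exact: glue_shift_continuous.
  by apply: openI => //; exact: open_in_band.
apply/seteqP; split=> p /=.
  move=> [[phi c] /= dc [Up bp]].
  exists (exist _ (glue_shift phi c (val p)) (mem_set bp)); first by rewrite -UE.
  by apply/esym/projP/torus_relP; exists phi, c.
move=> [q Uq] /esym/projP/torus_relP[phi [c [dc E]]]; exists (phi, c) => //=.
rewrite /glue_shift -E; split; first by move: Uq; rewrite -UE.
exact: bandP.
Qed.

(** If val p2 differs from the three transforms of val p1, then it is separated from
    each of them in B x R; intersecting the three pairs of neighbourhoods gives
    neighbourhoods whose projections are disjoint. *)
Lemma torus_hausdorff : hausdorff_space torus.
Proof.
have [hB _ _ _] := sB.
have hBR : forall u v : B * R, u <> v -> exists2 K1 : set (B * R), open K1 /\ K1 u &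
    exists2 K2 : set (B * R), open K2 /\ K2 v & forall w, K1 w -> K2 w -> False.
  move=> [x s] [y t] E.
  have sep (T S : topologicalType) (h : T -> S) (u v : T) : hausdorff_space S ->
      continuous h -> h u <> h v -> exists2 K1 : set T, open K1 /\ K1 u &
      exists2 K2 : set T, open K2 /\ K2 v & forall w, K1 w -> K2 w -> False.
    rewrite open_hausdorff => hS ch /eqP /hS[[K1 K2] /= [/set_mem Ou /set_mem Ov] [k1 k2 /eqP d]].
    exists (h @^-1` K1); first by split=> //; apply: open_comp => // *; exact: ch.
    exists (h @^-1` K2); first by split=> //; apply: open_comp => // *; exact: ch.
    by move=> w w1 w2; have : set0 (h w) by rewrite -d.
  have [xy|xy] := pselect (x = y).
    apply: (sep _ _ snd) => /=; [exact: Rhausdorff | by move=> ?; exact: cvg_snd |].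
    by move=> st; apply: E; rewrite xy st.
  by apply: (sep _ _ fst) => //= ?; exact: cvg_fst.
rewrite open_hausdorff => q1 q2; rewrite -(reprP q1) -(reprP q2).
set p1 := repr q1; set p2 := repr q2 => /eqP p12.
have sepd phi c : deck phi c -> exists2 K1 : set (B * R), open K1 /\ K1 (val p1) &
    exists2 K2 : set (B * R), open K2 /\ K2 (val p2) & forall w, K1 w -> K2 (glue_shift phi c w) -> False.
  move=> dc; have [|K1 [ oO1 O1p] [K2 [ oO2 O2p] d]] := hBR (glue_shift phi c (val p1)) (val p2).
    by move=> E; apply: p12; apply/projP/torus_relP; exists phi, c.
  exists (glue_shift phi c @^-1` K1); first by split=> //; apply: (continuousP _).1 => //; exact: glue_shift_continuous.
  by exists K2 => // w; exact: d.
have [A1 [ oA1 A1p] [A2 [ oA2 A2p] dA]] := sepd _ _ deck_id.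
have [B1 [ oB1 B1p] [B2 [ oB2 B2p] dB]] := sepd _ _ (Or32 _ _ (conj erefl erefl)).
have [C1 [ oC1 C1p] [C2 [ oC2 C2p] dC]] := sepd _ _ (Or33 _ _ (conj erefl erefl)).
pose U1 : set band := val @^-1` (A1 `&` B1 `&` C1).
pose U2 : set band := val @^-1` (A2 `&` B2 `&` C2).
exists (proj @` U1, proj @` U2) => /=.
  by split; apply/mem_set; [exists p1 | exists p2].
have oU1 : open U1 by exists (A1 `&` B1 `&` C1) => //; do 2?apply: openI.
have oU2 : open U2 by exists (A2 `&` B2 `&` C2) => //; do 2?apply: openI.
split; [exact: torus_proj_open oU1 | exact: torus_proj_open oU2|].
apply/eqP/seteqP; split=> // _ [[u [[Au Bu] Cu] <-] [v [[Av Bv] Cv]]].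
move=> /esym/projP/torus_relP[phi [c [dc E]]].
move: Av Bv Cv; rewrite E -/(glue_shift phi c (val u)).
by case: dc {E} => -[-> ->] Av Bv Cv; [exact: dA Av | exact: dB Bv | exact: dC Cv].
Qed.

Lemma torus_second_countable : @second_countable torus.
Proof.
have [_ [D cD [ oD nD]] _ _] := sB.
pose box (U : set B) (a b : rat) : set band :=
  val @^-1` [set p : B * R | U p.1 /\ ratr a < p.2 < ratr b].
exists [set V : set torus | exists U a b, D U /\ V = proj @` box U a b].
  have -> : [set V : set torus | exists U a b, D U /\ V = proj @` box U a b] =
      (fun x : set B * (rat * rat) => proj @` box x.1 x.2.1 x.2.2 : set torus) @` (D `*` setT).
    apply/seteqP; split=> V /=.
      by move=> [U [a [b [DU ->]]]]; exists (U, (a, b)).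
    by move=> [[U [a b]] /= [DU _] <-]; exists U, a, b.
  apply: sub_countable (card_image_le _ _) _; apply: countableX => //; exact: countableP.
split.
  move=> _ [U [a [b [DU ->]]]]; apply: torus_proj_open.
  exists [set p : B * R | U p.1 /\ ratr a < p.2 < ratr b] => //.
  have -> : [set p : B * R | U p.1 /\ ratr a < p.2 < ratr b] =
     (fst @^-1` U) `&` (snd @^-1` [set` `] ratr a, ratr b[ ]).
    by apply/seteqP; split=> p /=; rewrite in_itv.
  apply: openI; apply: open_comp; [by move=> *; exact: cvg_fst|exact: oD| |].
    by move=> *; exact: cvg_snd.
  exact: interval_open.
move=> q V /= Vq; have : nbhs q V := Vq; rewrite nbhsE => -[K [ oO Oq] OV].
have : nbhs (repr q) ((proj : band -> torus) @^-1` K).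
  by apply: torus_proj_continuous; rewrite reprP; exact: open_nbhs_nbhs.
rewrite nbhsE => -[_ [[K' oO' <-] K'q] K'K].
have : nbhs (val (repr q)) K' by exact: open_nbhs_nbhs.
move=> [[P Q] /= [Pq Qq] PQ].
have [U [DU Uq] UP] := nD _ _ Pq.
move: Qq => /nbhs_ballP[e /= e0 eQ]; set t := (val (repr q)).2.
have [a] : exists a : rat, ratr a \in `]t - e, t[.
  by apply: rat_in_itvoo; rewrite ltrBlDr ltrDl.
have [b] : exists b : rat, ratr b \in `]t, t + e[.
  by apply: rat_in_itvoo; rewrite ltrDl.
rewrite !in_itv /= => /andP[tb be] /andP[ea at'].
exists (proj @` box U a b) => /=.
  split; first by exists U, a, b.
  by exists (repr q); [split=> //; apply/andP | exact: reprP].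
move=> _ [p [Up /andP[ap pb]] <-]; apply/OV/K'K/PQ; split=> /=; first exact: UP.
by apply: eQ; rewrite /ball/= ltr_norml; rewrite -/t; lra.
Qed.

End torus.

(** * Product maps in coordinates *)
Section product_maps.
Context {R : realType}.

Lemma linear_rV_continuous m (W : normedModType R) (L : {linear 'rV[R]_m -> W}) : continuous L.
Proof.
have -> : (L : _ -> W) = \sum_j (fun u => coordL j u *: L (delta_mx 0 j)).
  apply/funext => u; rewrite fct_sumE {1}(row_sum_delta u) linear_sum.
  by apply: eq_bigr => j _; rewrite linearZ.
move=> u; elim/big_ind: _ => [|h1 h2 c1 c2|j _]; first exact: cst_continuous.
  exact: (continuousD c1 c2).
have cj : {for u, continuous (@coordL R m j)} by exact: coord_continuous.
exact: (cvgZ cj (cvg_cst (L (delta_mx 0 j)))).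
Qed.

Definition row_mxl m k (u : 'rV[R]_m) : 'rV[R]_(m + k) := row_mx u 0.
Definition row_mxr m k (u : 'rV[R]_k) : 'rV[R]_(m + k) := row_mx 0 u.
Lemma row_mxl_linear m k : linear (@row_mxl m k).
Proof. by move=> a u v; rewrite /row_mxl scale_row_mx add_row_mx scaler0 addr0. Qed.
Lemma row_mxr_linear m k : linear (@row_mxr m k).
Proof. by move=> a u v; rewrite /row_mxr scale_row_mx add_row_mx scaler0 addr0. Qed.
HB.instance Definition _ m k :=
  GRing.isLinear.Build R 'rV[R]_m 'rV[R]_(m + k) _ (@row_mxl m k) (@row_mxl_linear m k).
HB.instance Definition _ m k :=
  GRing.isLinear.Build R 'rV[R]_k 'rV[R]_(m + k) _ (@row_mxr m k) (@row_mxr_linear m k).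

Lemma row_mxlr m k (u : 'rV[R]_m) (v : 'rV[R]_k) : row_mx u v = row_mxl k u + row_mxr m v.
Proof. by rewrite /row_mxl /row_mxr add_row_mx addr0 add0r. Qed.

Lemma continuous_row_mx (T : topologicalType) m k (a : T -> 'rV[R]_m) (b : T -> 'rV[R]_k) x :
  {for x, continuous a} -> {for x, continuous b} ->
  {for x, continuous (fun y => row_mx (a y) (b y))}.
Proof.
move=> ca cb; have -> : (fun y => row_mx (a y) (b y)) =
    (@row_mxl m k \o a) + (@row_mxr m k \o b) by apply/funext => y; rewrite row_mxlr.
have c1 := continuous_comp ca (@linear_rV_continuous _ _ (@row_mxl m k) (a x)).
have c2 := continuous_comp cb (@linear_rV_continuous _ _ (@row_mxr m k) (b x)).
exact: (continuousD c1 c2).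
Qed.

(** The product of G with the translation by c: the shape of all transition maps of the
    torus. *)
Definition slide m k l (G : 'rV[R]_m -> 'rV[R]_l) (c : 'rV[R]_k) (y : 'rV[R]_(m + k)) :=
  row_mx (G (lsubmx y)) (rsubmx y + c).

Lemma smooth_near_slide m k l (G : 'rV[R]_m -> 'rV[R]_l) (c : 'rV[R]_k) y :
  smooth_near G (lsubmx y) -> smooth_near (slide G c) y.
Proof.
move=> sG; have sl : smooth_near (lsubmx : 'rV[R]_(m + k) -> _) y.
  by apply: smooth_near_linear; exact: continuous_lsubmx.
have sr : smooth_near (rsubmx : 'rV[R]_(m + k) -> _) y.
  by apply: smooth_near_linear; exact: continuous_rsubmx.
have -> : slide G c = (fun y => (@row_mxl l k \o (G \o lsubmx)) y +
    (@row_mxr l k \o (fun y => rsubmx y + c)) y) by apply/funext => z; rewrite -row_mxlr.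
apply: smooth_nearD; apply: smooth_near_linear_comp; try exact: linear_rV_continuous.
  exact: smooth_near_comp.
apply: smooth_nearD => //; exact: smooth_near_cst.
Qed.

Lemma jacobian_slide m k l (G : 'rV[R]_m -> 'rV[R]_l) (c : 'rV[R]_k) (y v : 'rV[R]_(m + k)) :
  smooth_near G (lsubmx y) ->
  v *m jacobian (slide G c) y = row_mx (lsubmx v *m jacobian G (lsubmx y)) (rsubmx v).
Proof.
move=> sG; have dG := smooth_near_differentiable sG.
have dF := smooth_near_differentiable (smooth_near_slide c sG).
have cl p q : continuous (lsubmx : 'rV[R]_(p + q) -> 'rV_p) by exact: continuous_lsubmx.
have cr p q : continuous (rsubmx : 'rV[R]_(p + q) -> 'rV_q) by exact: continuous_rsubmx.
have dl p q x : differentiable (lsubmx : 'rV[R]_(p + q) -> 'rV_p) x by exact: differentiable_lsubmx.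
have dr p q x : differentiable (rsubmx : 'rV[R]_(p + q) -> 'rV_q) x by exact: differentiable_rsubmx.
rewrite -(deriveEjacobian v dF) -[LHS]hsubmxK; congr row_mx.
  rewrite -[LHS](derive_linear (slide G c y) _ (cl l k)) -(derive_comp v dF (dl l k _)).
  have -> : (lsubmx : 'rV[R]_(l + k) -> 'rV[R]_l) \o slide G c = G \o lsubmx.
    by apply/funext => z; rewrite /= row_mxKl.
  by rewrite (derive_comp v (dl m k y) dG) (derive_linear _ _ (cl m k)) (deriveEjacobian _ dG).
rewrite -[LHS](derive_linear (slide G c y) _ (cr l k)) -(derive_comp v dF (dr l k _)).
have -> : (rsubmx : 'rV[R]_(l + k) -> 'rV[R]_k) \o slide G c = (rsubmx : 'rV[R]_(m + k) -> 'rV[R]_k) + cst c.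
  by apply/funext => z; rewrite /= row_mxKr.
rewrite deriveD ?derive_cst ?addr0 ?(derive_linear _ _ (cr m k))//.
  exact/diff_derivable/dr.
Qed.
End product_maps.

(** * The mapping torus is a smooth manifold *)
Section torus_charts.
Context {R : realType} {n : nat} {B : charted R n}.
Variables (f g : B -> B) (eps : R).
Hypotheses (sB : smooth_manifold B) (sf : smooth_map f) (sg : smooth_map g).
Hypotheses (fK : cancel f g) (gK : cancel g f) (epsP : 0 < eps < 2^-1).

Notation band := (@Defs.band R n B eps).
Notation torus := (mapping_torus f eps).
Notation proj := (@torus_proj R n B f eps).
Notation deck := (deck f g).

Lemma deck0 phi : deck phi 0 -> phi = id.
Proof. by case=> -[-> //] /eqP; rewrite eq_sym ?oppr_eq0 oner_eq0. Qed.

Lemma deck_norm phi c : deck phi c -> `|c| < 1 -> phi = id /\ c = 0.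
Proof. by case=> -[-> ->] //; rewrite ?normrN normr1 ltxx. Qed.

(** box, tdom are the domain of torus_chart r lifted to B x R and its image in
    R^(n+1); tcoord and tpoint are the coordinates and their inverse, before
    projection to the torus. *)
Definition box (r : band) (p : B * R) : Prop :=
  cdom (chart_at (val r).1) p.1 /\ `|p.2 - (val r).2| < 2^-1.
Definition tcoord (r : band) (p : B * R) : 'rV[R]_(n + 1) :=
  row_mx (cmap (chart_at (val r).1) p.1) (const_mx p.2).
Definition tpoint (r : band) (y : 'rV[R]_(n + 1)) : B * R :=
  (cinv (chart_at (val r).1) (lsubmx y), rsubmx y 0 0).
Definition tdom (r : band) : set 'rV[R]_(n + 1) := [set y |
    [/\ cimg (chart_at (val r).1) (lsubmx y), - eps < rsubmx y 0 0 < 1 + eps &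
        `|rsubmx y 0 0 - (val r).2| < 2^-1]].

Lemma tcoordK r p : box r p -> tpoint r (tcoord r p) = p.
Proof.
move=> [cp _]; rewrite /tpoint /tcoord row_mxKl row_mxKr mxE cmapK //.
  by case: p cp.
exact: chart_at_axioms.
Qed.

Lemma tpointK r y : tdom r y -> tcoord r (tpoint r y) = y.
Proof.
move=> [cy _ _]; rewrite /tcoord /tpoint /= cinvK //; last exact: chart_at_axioms.
rewrite -[RHS]hsubmxK; congr row_mx; apply/rowP => j; rewrite !mxE.
by rewrite (ord1 j).
Qed.

Lemma box_tpoint r y : tdom r y -> box r (tpoint r y).
Proof. by move=> [cy _ ry]; split=> //=; apply: cdom_cinv => //; exact: chart_at_axioms. Qed.

Lemma in_band_tpoint r y : tdom r y -> @in_band R n B eps (tpoint r y).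
Proof. by case. Qed.

Lemma tdom_tcoord r p : box r p -> @in_band R n B eps p -> tdom r (tcoord r p).
Proof.
move=> [cp tp] bp; split; rewrite /tcoord ?row_mxKl ?row_mxKr ?mxE //.
exact: cimg_cmap.
Qed.

Lemma cinv_torus_chart (r : band) y : cinv (torus_chart f r) y = proj (insubd r (tpoint r y)).
Proof. by []. Qed.

Lemma val_insubd_band (r : band) p : @in_band R n B eps p -> val (insubd r p) = p.
Proof. by move=> bp; rewrite insubdK //; exact/mem_set. Qed.

Lemma cinv_tcoord r (p : band) : box r (val p) ->
  cinv (torus_chart f r) (tcoord r (val p)) = proj p.
Proof.
move=> bp; rewrite cinv_torus_chart tcoordK//; congr (proj _).
by apply: val_inj; rewrite val_insubd_band//; exact: bandP.
Qed.

(** Identified points have values of t differing by 0 or 1, and the values of t in the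
    domain of a chart are less than 1 apart. *)
Lemma cinv_torus_chart_inj r : {in tdom r &, injective (cinv (torus_chart f r))}.
Proof.
move=> y z /set_mem dy /set_mem dz; rewrite !cinv_torus_chart.
move=> /projP/(torus_relP fK gK epsP)[phi [c [dc]]].
rewrite !val_insubd_band; [|exact: in_band_tpoint|exact: in_band_tpoint].
move=> E; rewrite -(tpointK dy) -(tpointK dz).
have [[_ _ ry] [_ _ rz]] := (dy, dz).
have [phiE cE] : phi = id /\ c = 0.
  apply: (deck_norm dc); move: ry rz; case: E => _ ->; rewrite !ltr_norml; lra.
by congr (tcoord r _); rewrite E phiE cE addr0 -surjective_pairing.
Qed.

Lemma cmap_torus_chart_tdom r y : tdom r y -> cmap (torus_chart f r) (cinv (torus_chart f r) y) = y.
Proof.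
by move=> dy; exact: (pinvKV _ (@cinv_torus_chart_inj r) (mem_set dy)).
Qed.

Lemma cmap_torus_chart r (p : band) : box r (val p) ->
  cmap (torus_chart f r) (proj p) = tcoord r (val p).
Proof.
move=> bp; rewrite -(cinv_tcoord bp) cmap_torus_chart_tdom//.
by apply: tdom_tcoord => //; exact: bandP.
Qed.

Lemma cdom_torus_chartE r : cdom (torus_chart f r) = proj @` [set p | box r (val p)].
Proof.
apply/seteqP; split=> q.
  move=> [y dy <-]; exists (insubd r (tpoint r y)) => //=.
  by rewrite val_insubd_band; [exact: box_tpoint | exact: in_band_tpoint].
move=> [p bp <-]; exists (tcoord r (val p)); last exact: cinv_tcoord.
by apply: tdom_tcoord => //; exact: bandP.
Qed.

Lemma cimg_torus_chart r : cimg (torus_chart f r) = tdom r.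
Proof.
apply/seteqP; split=> y.
  by move=> [_ [z dz <-] <-]; rewrite cmap_torus_chart_tdom.
by move=> dy; exists (cinv (torus_chart f r) y); [exists y | exact: cmap_torus_chart_tdom].
Qed.

Lemma open_ball_at (t e : R) : open [set s : R | `|s - t| < e].
Proof.
have -> : [set s : R | `|s - t| < e] = ball t e.
  by apply/seteqP; split=> s; rewrite /ball /= distrC.
exact: ball_open.
Qed.

Lemma open_box r : open (box r).
Proof.
have -> : box r = fst @^-1` (cdom (chart_at (val r).1)) `&`
    snd @^-1` [set s : R | `|s - (val r).2| < 2^-1] by [].
apply: openI; apply: (continuousP _).1.
- by move=> p; exact: cvg_fst.
- by have [] := chart_at_axioms sB (val r).1.
- by move=> p; exact: cvg_snd.
- exact: open_ball_at.
Qed.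

Lemma last_continuous : continuous (fun y : 'rV[R]_(n + 1) => rsubmx y 0 0).
Proof.
move=> y; apply: (@continuous_comp _ _ _ rsubmx (fun z : 'rV[R]_1 => z 0 0)).
  exact: continuous_rsubmx.
exact: coord_continuous.
Qed.

Lemma open_tdom r : open (tdom r).
Proof.
have -> : tdom r = lsubmx @^-1` (cimg (chart_at (val r).1)) `&`
    (fun y : 'rV[R]_(n + 1) => rsubmx y 0 0) @^-1`
      ([set` `] - eps, 1 + eps[ ] `&` [set s : R | `|s - (val r).2| < 2^-1]).
  by apply/seteqP; split=> y /=; rewrite in_itv /= => -[] // ? []; split.
apply: openI; apply: (continuousP _).1.
- exact: continuous_lsubmx.
- by have [] := chart_at_axioms sB (val r).1.
- exact: last_continuous.
- by apply: openI; [exact: interval_open | exact: open_ball_at].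
Qed.

Lemma tcoord_continuous r p : box r p -> {for p, continuous (tcoord r)}.
Proof.
move=> [cp _]; apply: continuous_row_mx.
  apply: (@continuous_comp _ _ _ fst (cmap (chart_at (val r).1))).
    exact: cvg_fst.
  exact: (cmap_continuous (chart_at_axioms sB _)).
have -> : (fun y : B * R => const_mx y.2 : 'rV[R]_1) = (fun y => y.2 *: const_mx 1).
  by apply/funext => y; apply/rowP => j; rewrite !mxE mulr1.
by apply: cvgZ; [exact: cvg_snd | exact: cvg_cst].
Qed.

Lemma tpoint_continuous r y : tdom r y -> {for y, continuous (tpoint r)}.
Proof.
move=> [cy _ _]; have c1 : {for y, continuous (fun y : 'rV[R]_(n + 1) =>
    cinv (chart_at (val r).1) (lsubmx y))}.
  apply: continuous_comp; first exact: continuous_lsubmx.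
  exact: (cinv_continuous (chart_at_axioms sB _)).
exact: cvg_pair c1 (@last_continuous y).
Qed.

Lemma torus_chart_axioms (r : band) : chart_axioms (torus_chart f r).
Proof.
split.
- rewrite cdom_torus_chartE.
  have oU : open (val @^-1` box r : set band) by exists (box r) => //; exact: open_box.
  exact: (torus_proj_open sB sf sg fK gK epsP oU).
- rewrite cimg_torus_chart; exact: open_tdom.
- by move=> q [y dy <-]; rewrite cmap_torus_chart_tdom.
- rewrite cdom_torus_chartE => _ [p bp <-] V.
  rewrite cmap_torus_chart// => Vp.
  have : nbhs (val p) (box r `&` tcoord r @^-1` V).
    by apply: filterI; [apply: open_nbhs_nbhs; split=> //; exact: open_box|exact: tcoord_continuous].
  rewrite nbhsE => -[U [oU Up] UV].
  have : nbhs (proj p : torus) (proj @` (val @^-1` U)).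
    apply: open_nbhs_nbhs; split; last by exists p.
    have oU' : open (val @^-1` U : set band) by exists U.
    exact: (torus_proj_open sB sf sg fK gK epsP oU').
  apply: filterS => _ [q Uq <-]; have [bq Vq] := UV _ Uq.
  by change (V (cmap (torus_chart f r) (proj q))); rewrite cmap_torus_chart.
- rewrite cimg_torus_chart => y dy V.
  rewrite cinv_torus_chart => Vy.
  have : nbhs (insubd r (tpoint r y) : band) ((proj : band -> torus) @^-1` V).
    exact: torus_proj_continuous.
  rewrite nbhsE => -[_ [[U oU <-] Uy] UV].
  have : nbhs y (tdom r `&` tpoint r @^-1` U).
    apply: filterI; first by apply: open_nbhs_nbhs; split=> //; exact: open_tdom.
    apply: tpoint_continuous => //; apply: open_nbhs_nbhs; split=> //.
    have : U (val (insubd r (tpoint r y))) := Uy.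
    by rewrite val_insubd_band//; exact: in_band_tpoint.
  apply: filterS => z [dz Uz]; apply: (UV (insubd r (tpoint r z))).
  by change (U (val (insubd r (tpoint r z)))); rewrite val_insubd_band//; exact: in_band_tpoint.
Qed.

(** Near p the chart r1 lifts points of the torus close to p, the chart r2 lifts them
    close to the image of p under a deck transformation phi; the two lifts differ by
    phi. *)
Lemma torus_transition (r1 r2 p : band) phi c : deck phi c ->
  box r1 (val p) -> box r2 (glue_shift phi c (val p)) ->
  @in_band R n B eps (glue_shift phi c (val p)) ->
  {near tcoord r1 (val p),
    slide (cmap (chart_at (val r2).1) \o phi \o cinv (chart_at (val r1).1)) (const_mx c)
    =1 cmap (torus_chart f r2) \o cinv (torus_chart f r1)}.
Proof.
move=> dc b1 b2 bp; have d1 : tdom r1 (tcoord r1 (val p)).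
  by apply: tdom_tcoord => //; exact: bandP.
have : nbhs (tcoord r1 (val p)) (tdom r1 `&`
    (glue_shift phi c \o tpoint r1) @^-1` (box r2 `&` @in_band R n B eps)).
  apply: filterI; first by apply: open_nbhs_nbhs; split=> //; exact: open_tdom.
  have cc : {for tcoord r1 (val p), continuous (glue_shift phi c \o tpoint r1)}.
    exact: continuous_comp (tpoint_continuous d1) (@glue_shift_continuous _ _ _ _ _ sB sf sg _ _ dc _).
  apply: cc; rewrite [X in nbhs X](_ : _ = glue_shift phi c (val p)); last first.
    by rewrite /comp tcoordK.
   apply: open_nbhs_nbhs; split=> //.
  by apply: openI; [exact: open_box | exact: open_in_band].
apply: filterS => y [dy [by2 bby]].
apply: (@etrans _ _ (tcoord r2 (glue_shift phi c (tpoint r1 y)))).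
  rewrite /tcoord /slide /=; congr row_mx.
  by apply/rowP => j; rewrite !mxE (ord1 j).
apply: (@etrans _ _ (cmap (torus_chart f r2) (proj (insubd r2 (glue_shift phi c (tpoint r1 y)))))).
  by rewrite cmap_torus_chart val_insubd_band.
congr (cmap (torus_chart f r2) _); apply/esym/projP/(torus_relP fK gK epsP); exists phi, c.
by split=> //; rewrite !val_insubd_band//; exact: in_band_tpoint.
Qed.

Lemma transition_slide_smooth (a b : B) phi c x (k : 'rV[R]_1) y : deck phi c ->
  cdom (chart_at a) x -> cdom (chart_at b) (phi x) ->
  lsubmx y = cmap (chart_at a) x ->
  smooth_near (slide (cmap (chart_at b) \o phi \o cinv (chart_at a)) k) y.
Proof.
move=> dc ax bx yE; apply: smooth_near_slide; rewrite yE.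
apply: smooth_map_near => //; exact: (deck_smooth sB sf sg dc).
Qed.

Lemma smooth_mapping_torus : smooth_manifold torus.
Proof.
split.
- exact: (torus_hausdorff sB sf sg fK gK epsP).
- exact: (torus_second_countable sB sf sg fK gK epsP).
- move=> q; split; first exact: torus_chart_axioms.
  rewrite cdom_torus_chartE; exists (repr q); last exact: reprP.
  by split; [exact: cdom_chart_at | rewrite subrr normr0 invr_gt0].
- move=> q1 q2; rewrite smooth_onP; last first.
    apply: (chart_image_open (torus_chart_axioms _)).
    by have [] := torus_chart_axioms (repr q2).
  move=> _ [q [d1 d2] <-].
  have : cdom (torus_chart f (repr q1)) q := d1.
  rewrite cdom_torus_chartE => -[p1 b1 p1q].
  have : cdom (torus_chart f (repr q2)) q := d2.
  rewrite cdom_torus_chartE => -[p2 b2 p2q].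
  change (smooth_near (cmap (torus_chart f (repr q2)) \o cinv (torus_chart f (repr q1)))
    (cmap (torus_chart f (repr q1)) q)).
  have /projP/(torus_relP fK gK epsP)[phi [c [dc E]]] : proj p1 = proj p2 by rewrite p1q p2q.
  rewrite -p1q cmap_torus_chart//.
  have bb : @in_band R n B eps (val p2) by exact: bandP.
  apply: smooth_near_eq (torus_transition dc b1 _ _) _; try by rewrite /glue_shift -E.
  apply: (transition_slide_smooth _ (x := (val p1).1) dc).
  + by case: b1.
  + by move: b2; rewrite /= E => -[].
  + by rewrite /tcoord row_mxKl.
Qed.

End torus_charts.

(** * The contact pair *)
Section forms_on_charted.
Context {R : realType} {n : nat} {M : charted R n}.
Hypothesis sM : smooth_manifold M.

Lemma in_chart_differentiable k (a : M -> kform R n k) (p x : M) v : differential_form a ->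
  cdom (chart_at p) x ->
  smooth_near (fun y => in_chart (chart_at p) a y v : R^o) (cmap (chart_at p) x).
Proof.
move=> [_ /(_ p v)] + px; rewrite smooth_onP; last by have [] := chart_at_axioms sM p.
by apply; exact: cimg_cmap.
Qed.

Lemma ext_d_multilinear k (a : M -> kform R n k) p : differential_form a ->
  multilinear (ext_d a p).
Proof.
move=> da; apply: ext_deriv_multilinear => [y|v].
  exact/multilinear_mulmx/(da.1 _).1.
apply/smooth_near_differentiable/in_chart_differentiable => //; exact: cdom_chart_at.
Qed.

End forms_on_charted.

Section torus_forms.
Context {R : realType} {n : nat} {B : charted R n}.
Variables (f g : B -> B) (eps : R) (w : B -> kform R n 1).
Hypotheses (sB : smooth_manifold B) (sf : smooth_map f) (sg : smooth_map g).
Hypotheses (fK : cancel f g) (gK : cancel g f) (epsP : 0 < eps < 2^-1).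
Hypotheses (dw : differential_form w) (fw : pullback f w = w).

Notation band := (@Defs.band R n B eps).
Notation torus := (mapping_torus f eps).
Notation proj := (@torus_proj R n B f eps).
Notation deck := (deck f g).

Let sT : smooth_manifold torus := smooth_mapping_torus sB sf sg fK gK epsP.

(** For f^-1 this follows from f^* w = w by functoriality of the pullback. *)
Lemma deck_pullback phi c : deck phi c -> pullback phi w = w.
Proof.
have pb_id : pullback id w = w.
  apply/funext => x; apply/funext => v.
  change (w x (v *m tangent_map id x) = w x v).
  by rewrite (tangent_map_id sB) mulmx1.
case=> -[-> _]; [exact: pb_id | exact: fw |].
apply/funext => x; apply/funext => v; rewrite -[in RHS]pb_id.
have <- : f \o g = id by apply/funext.
have E : w (f (g x)) (v *m tangent_map g x *m tangent_map f (g x)) =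
    w (g x) (v *m tangent_map g x).
  exact: (congr1 (fun W => W (g x) (v *m tangent_map g x)) fw).
change (w (g x) (v *m tangent_map g x) = w (f (g x)) (v *m tangent_map (f \o g) x)).
have T := tangent_map_comp sB sB sB x sg sf.
exact: (etrans (esym E) (congr1 (w (f (g x))) (etrans (esym (mulmxA _ _ _)) (congr1 (mulmx v) (esym T))))).
Qed.

Lemma box_self (r : band) : box r (val r).
Proof. by split; [exact: cdom_chart_at | rewrite subrr normr0 invr_gt0]. Qed.

Lemma repr_deck (p : band) : exists phi c, deck phi c /\
  val (repr (proj p)) = glue_shift phi c (val p).
Proof.
have /projP/(torus_relP fK gK epsP) : proj p = proj (repr (proj p)).
  exact/esym/(reprP (f := f)).
by [].
Qed.

(** The differential of the transition from a chart r to the preferred chart at a point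
    q: it preserves the component along t, and acts on the component along B as the
    transition to the preferred chart at z followed by the differential of the deck
    transformation that sends z to the preferred representative of q. *)
Lemma torus_transition_jacobian (r : band) y : tdom r y ->
  let q := cinv (torus_chart f r) y in
  let z := cinv (chart_at (val r).1) (lsubmx y) in
  exists phi c, [/\ deck phi c, (val (repr q)).1 = phi z &
    forall v : 'rV[R]_(n + 1), v *m jacobian (cmap (chart_at (q : torus)) \o cinv (torus_chart f r)) y =
      row_mx (lsubmx v *m jacobian (cmap (chart_at z) \o cinv (chart_at (val r).1)) (lsubmx y)
                *m tangent_map phi z) (rsubmx v)].
Proof.
move=> dy q z; pose p0 : band := insubd r (tpoint r y).
have p0E : val p0 = tpoint r y by rewrite val_insubd_band//; exact: in_band_tpoint.
have [phi [c [dc rE]]] := repr_deck p0.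
exists phi, c; split=> //; first by rewrite /q cinv_torus_chart -/p0 rE p0E.
move=> v; have cz : cdom (chart_at (val r).1) z.
  by apply: cdom_cinv; [exact: chart_at_axioms | case: dy].
have yE : lsubmx y = cmap (chart_at (val r).1) z.
  by rewrite cinvK//; [exact: chart_at_axioms | case: dy].
have rz : (val (repr (proj p0))).1 = phi z by rewrite rE p0E.
have b1 : box r (val p0) by rewrite p0E; exact: box_tpoint.
have b2 : box (repr (proj p0)) (glue_shift phi c (val p0)) by rewrite -rE; exact: box_self.
have bb : @in_band R n B eps (glue_shift phi c (val p0)) by rewrite -rE; exact: bandP.
have := torus_transition sB sf sg fK gK epsP dc b1 b2 bb.
rewrite p0E tpointK// rz => tr.
have sG : smooth_near (cmap (chart_at (phi z)) \o phi \o cinv (chart_at (val r).1)) (lsubmx y).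
  rewrite yE; apply: smooth_map_near => //; last exact: cdom_chart_at.
  exact: deck_smooth dc.
have dS := smooth_near_differentiable (smooth_near_slide (const_mx c) sG).
have jE := near_eq_jacobian tr dS.
apply: (etrans (congr1 (mulmx v) (esym jE))).
have H := @jacobian_slide R n 1 n _ (const_mx c) y v sG.
have E := jacobian_tangent_map sB sB (deck_smooth sB sf sg dc) cz.
rewrite -yE in E.
have E' := etrans (congr1 (mulmx (lsubmx v)) E) (mulmxA _ _ _).
exact: (etrans H (congr1 (fun t => row_mx t (rsubmx v)) E')).
Qed.

(** The forms induced by w and dt.  They are read at the preferred representative of q,
    whose chart is the one through which tangent vectors are represented. *)
Definition torus_form : torus -> kform R (n + 1) 1 :=
  fun q v => w (val (repr q)).1 (lsubmx v).
Definition torus_dt : torus -> kform R (n + 1) 1 := fun q v => rsubmx v 0 0.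

(** The deck transformation in torus_transition_jacobian is absorbed by the
    invariance of w. *)
Lemma in_chart_torus_form (r : band) y (v : 'M[R]_(1, n + 1)) : tdom r y ->
  in_chart (M := torus) (torus_chart f r) torus_form y v =
  in_chart (chart_at (val r).1) w (lsubmx y) (lsubmx v).
Proof.
move=> /torus_transition_jacobian[phi [c [dc rE vE]]].
rewrite /in_chart /torus_form rE vE row_mxKl.
by have /funeqP/(_ (cinv (chart_at (val r).1) (lsubmx y)))/funeqP <- := deck_pullback dc.
Qed.

Lemma in_chart_torus_dt (r : band) y (v : 'M[R]_(1, n + 1)) : tdom r y ->
  in_chart (M := torus) (torus_chart f r) torus_dt y v = rsubmx v 0 0.
Proof.
move=> /torus_transition_jacobian[phi [c [dc rE vE]]].
by rewrite /in_chart /torus_dt vE row_mxKr.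
Qed.

Lemma near_tdom (r : band) y : tdom r y -> nbhs y (tdom r).
Proof. by move=> dy; apply: open_nbhs_nbhs; split=> //; exact: open_tdom. Qed.

Lemma one_form_alternating (a : kform R (n + 1) 1) : Defs.alternating a.
Proof. by move=> A i j; rewrite (ord1 i) (ord1 j) eqxx. Qed.

Lemma torus_form_differential : differential_form torus_form.
Proof.
split=> [p|p v].
  split; last exact: one_form_alternating.
  move=> A C D i b c rA CA DA.
  have rE (X : 'M[R]_(1, n + 1)) : row i (lsubmx X) = lsubmx (row i X).
    by apply/rowP => j; rewrite !mxE.
  have r'E (X : 'M[R]_(1, n + 1)) : row' i (lsubmx X) = lsubmx (row' i X).
    by apply/matrixP => ? ?; rewrite !mxE.
  apply: ((dw.1 _).1 _ _ _ i); rewrite ?rE ?r'E ?CA ?DA ?rA //.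
  by rewrite linearD !linearZ.
rewrite smooth_onP; last by have [] := chart_at_axioms sT p.
move=> y; have -> : cimg (chart_at p) = tdom (repr p).
  exact: (cimg_torus_chart sB fK gK epsP).
move=> dy; have [iy _ _] := dy.
pose F := fun x : 'rV[R]_n => in_chart (chart_at (val (repr p)).1) w x (lsubmx v) : R^o.
apply: (@smooth_near_eq _ _ _ (F \o lsubmx)).
  apply: filterS (near_tdom dy) => z dz; exact/esym/in_chart_torus_form.
apply: smooth_near_comp.
  by apply: smooth_near_linear; exact: continuous_lsubmx.
rewrite -(cinvK (chart_at_axioms sB _) iy).
by apply: in_chart_differentiable => //; apply: cdom_cinv => //; exact: chart_at_axioms.
Qed.

Lemma torus_dt_differential : differential_form torus_dt.
Proof.
split=> [p|p v].
  split; last exact: one_form_alternating.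
  move=> A C D i b c + _ _; rewrite (ord1 i) => /rowP/(_ (rshift n 0)).
  by rewrite /torus_dt !mxE.
rewrite smooth_onP; last by have [] := chart_at_axioms sT p.
move=> y; have -> : cimg (chart_at p) = tdom (repr p).
  exact: (cimg_torus_chart sB fK gK epsP).
move=> dy; apply: (@smooth_near_eq _ _ _ (fun=> rsubmx v 0 0 : R^o)); last exact: smooth_near_cst.
by apply: filterS (near_tdom dy) => z dz; exact/esym/in_chart_torus_dt.
Qed.

Lemma cmap_torus_self (q : torus) : cmap (chart_at q) q = tcoord (repr q) (val (repr q)).
Proof.
by rewrite -(cmap_torus_chart sB fK gK epsP (box_self _)) (reprP (f := f)).
Qed.

Lemma tdom_self (q : torus) : tdom (repr q) (cmap (chart_at q) q).
Proof.
rewrite cmap_torus_self; apply: tdom_tcoord; first exact: box_self.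
exact: bandP.
Qed.

Lemma ext_d_torus_form (q : torus) (v : 'M[R]_(2, n + 1)) :
  ext_d torus_form q v = ext_d w (val (repr q)).1 (lsubmx v).
Proof.
have dy := tdom_self q; have yE := cmap_torus_self q.
rewrite /ext_d /ext_deriv; apply: eq_bigr => i _; congr (_ * _).
pose F := fun x : 'rV[R]_n =>
  in_chart (chart_at (val (repr q)).1) w x (lsubmx (row' i v)) : R^o.
have sF : smooth_near F (lsubmx (cmap (chart_at q) q)).
  rewrite yE /tcoord row_mxKl.
  by apply: in_chart_differentiable => //; exact: cdom_chart_at.
have dF := smooth_near_differentiable sF.
have dl : differentiable (lsubmx : 'rV[R]_(n + 1) -> 'rV[R]_n) (cmap (chart_at q) q).
  exact: differentiable_lsubmx.
have nE : {near cmap (chart_at q) q,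
    (fun y => in_chart (chart_at q) torus_form y (row' i v) : R^o) =1 F \o lsubmx}.
  by apply: filterS (near_tdom dy) => z dz; exact: in_chart_torus_form.
apply: (etrans (near_eq_derive _ nE)).
rewrite (derive_comp _ dl dF) (derive_linear (L := lsubmx)); last exact: continuous_lsubmx.
rewrite yE /tcoord row_mxKl.
have E1 : lsubmx (row i v) = row i (lsubmx v) by apply/rowP => j; rewrite !mxE.
have E : lsubmx (row' i v) = row' i (lsubmx v) by apply/matrixP => ? ?; rewrite !mxE.
apply: (etrans (congr1 (fun u => 'D_u F _) E1)).
by rewrite /F E.
Qed.

Lemma ext_d_torus_dt (q : torus) v : ext_d torus_dt q v = 0.
Proof.
rewrite /ext_d /ext_deriv big1// => i _.
have nE : {near cmap (chart_at q) q,
    (fun y => in_chart (chart_at q) torus_dt y (row' i v) : R^o) =1 cst (rsubmx (row' i v) 0 0)}.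
  by apply: filterS (near_tdom (tdom_self q)) => z dz; exact: in_chart_torus_dt.
apply: (etrans (congr1 _ (near_eq_derive _ nE))).
by rewrite derive_cst mulr0.
Qed.

(** As torus_dt is closed, only the condition on its value remains. *)
Lemma torus_dt_kernel (q : torus) :
  characteristic_distribution torus_dt q = [set v | rsubmx v 0 0 = 0].
Proof.
apply/seteqP; split=> v; first by case.
by move=> v0; split=> // u; exact: ext_d_torus_dt.
Qed.

Lemma contact_pair_torus h : contact_manifold h w -> contact_pair h 0 torus_form torus_dt.
Proof.
move=> [_ nh _ nzw].
have LE k (v : 'M[R]_(k, n + 1)) : lsubmx v = v *m lsubmx 1%:M.
  by rewrite mulmx_lsub mulmx1.
have formE q : torus_form q = fun u => w (val (repr q)).1 (u *m lsubmx 1%:M).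
  by apply/funext => u; rewrite -LE.
have dformE q : ext_d torus_form q = fun u => ext_d w (val (repr q)).1 (u *m lsubmx 1%:M).
  by apply/funext => u; rewrite ext_d_torus_form LE.
have ddtE q : ext_d torus_dt q = fun=> 0.
  by apply/funext => u; rewrite ext_d_torus_dt.
split.
- by split=> //; rewrite nh muln0 addn0 -addnA.
- by split; [exact: torus_form_differential | exact: torus_dt_differential].
- move=> q v; rewrite dformE wedge_pow_mulmx; apply: alternating_form_eq0.
  + by apply: wedge_pow_multilinear; exact: ext_d_multilinear.
  + exact/antisymmetric_alternating/wedge_antisymmetric.
    by rewrite nh (mulnC 2 h) mulSn addnC ltn_add2r.
- move=> q v; rewrite ddtE /wedge_pow /wedge big1 ?mulr0// => s _.
  by rewrite mul0r mulr0.
move=> q; have [v0 v0P] := nzw (val (repr q)).1.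
set X := wedge _ _ in v0P.
have asX : antisymmetric_form X by exact: wedge_antisymmetric.
have inner : wedge (torus_form q) (wedge_pow (ext_d torus_form q) h) = fun u => X (lsubmx u).
  apply/funext => u; rewrite LE formE dformE; apply: etrans (wedge_mulmx _ _ _ _).
  congr (wedge _ _ _).
  by apply/funext => u'; rewrite wedge_pow_mulmx.
rewrite inner.
have bE (s : 'S_(1 + h * 2 + 1)) :
    torus_dt q (dsubmx (row_perm s (block_mx v0 0 0 (1%:M : 'M[R]_1)))) =
     ([forall j, s (rshift _ j) == rshift _ j])%:R.
  have -> : [forall j, s (rshift _ j) == rshift _ j] = (s (rshift _ ord0) == rshift _ (ord0 : 'I_1)).
    apply/forallP/idP => [/(_ ord0)//|s0 j]; by rewrite (ord1 j).
  rewrite /torus_dt !mxE.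
  move: (splitK (s (rshift (1 + h * 2) ord0))).
  case: (fintype.split _) => j /= <-; rewrite ?(unsplitK (inl _)) ?(unsplitK (inr _)).
    by rewrite mxE (unsplitK (inr _)) mxE eq_lrshift.
  by rewrite mxE (unsplitK (inr _)) mxE eq_rshift (ord1 j).
have [c c0 cE] := wedge_block asX bE.
set Y := wedge (fun u => X (lsubmx u)) (torus_dt q) in cE *.
have asY : antisymmetric_form Y by exact: wedge_antisymmetric.
have [d d0 dE] := @wedge_scalar R (n + 1) _ (0 * 2) Y
   (block_mx v0 0 0 (1%:M : 'M[R]_1)) 0 erefl asY.
exists (col_mx (block_mx v0 0 0 (1%:M : 'M[R]_1)) 0).
rewrite dE cE; exact: (mulf_neq0 d0 (mulf_neq0 c0 v0P)).
Qed.

End torus_forms.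

(** * The fibers of the torus are integral manifolds *)
Section fibers.
Context {R : realType} {n : nat} {B : charted R n}.
Variables (f g : B -> B) (eps : R) (w : B -> kform R n 1).
Hypotheses (sB : smooth_manifold B) (sf : smooth_map f) (sg : smooth_map g).
Hypotheses (fK : cancel f g) (gK : cancel g f) (epsP : 0 < eps < 2^-1).
Hypotheses (dw : differential_form w) (fw : pullback f w = w).

Notation band := (@Defs.band R n B eps).
Notation torus := (mapping_torus f eps).
Notation proj := (@torus_proj R n B f eps).
Notation deck := (deck f g).

Let sT : smooth_manifold torus := smooth_mapping_torus sB sf sg fK gK epsP.

Variables (t : R) (bt : - eps < t < 1 + eps).

Definition band_pt (b : B) : band := exist _ (b, t) (mem_set bt).
Definition fiber (b : B) : torus := proj (band_pt b).

Lemma val_band_pt b : val (band_pt b) = (b, t). Proof. by []. Qed.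

Lemma band_pt_continuous : continuous band_pt.
Proof.
move=> b V; rewrite nbhsE => -[_ [[U oU <-] Ub] UV].
have cb : {for b, continuous (fun b : B => (b, t))}.
  have c1 : {for b, continuous (fun b : B => b)} by exact: cvg_id.
  have c2 : {for b, continuous (fun _ : B => t)} by exact: cvg_cst.
  exact: cvg_pair c1 c2.
have Un : nbhs (b, t) U by apply: open_nbhs_nbhs.
have cU : nbhs b [set b' | U (b', t)] := cb _ Un.
by apply: filterS cU => b' Ub'; apply: UV.
Qed.

Lemma fiber_continuous : continuous fiber.
Proof.
move=> b; exact: (continuous_comp (@band_pt_continuous b)
  (@torus_proj_continuous R n B f eps (band_pt b))).
Qed.

Lemma fiber_inj : injective fiber.
Proof.
move=> b b' /projP/(torus_relP fK gK epsP)[phi [c [dc]]]; rewrite !val_band_pt.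
move=> [bE /eqP]; rewrite -subr_eq0 opprD addrA subrr add0r oppr_eq0 => /eqP c0.
by rewrite c0 in dc; rewrite bE (deck0 dc).
Qed.

Lemma repr_fiber b : exists phi c, deck phi c /\ val (repr (fiber b)) = (phi b, t + c).
Proof. exact: (repr_deck fK gK epsP). Qed.

(** The preferred representative of [b, t] is (phi b, t + c) for a deck transformation
    phi, hence the occurrence of phi in the expression of the fiber in charts. *)
Lemma fiber_near b phi c : deck phi c -> val (repr (fiber b)) = (phi b, t + c) ->
  {near cmap (chart_at b) b,
    (fun y => @row_mxl R n 1 ((cmap (chart_at (phi b)) \o phi \o cinv (chart_at b)) y)
       + row_mx 0 (const_mx (t + c)))
    =1 cmap (chart_at (fiber b)) \o fiber \o cinv (chart_at b)}.
Proof.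
move=> dc rE; have sphi := deck_smooth sB sf sg dc.
have : nbhs b (phi @^-1` cdom (chart_at (phi b))).
  apply: (smooth_map_continuous sphi); apply: near_cdom (cdom_chart_at sB _).
  exact: chart_at_axioms.
move=> /(near_cinv (chart_at_axioms sB b) (cdom_chart_at sB b)).
apply: filterS => y [iy phiy].
have btc : - eps < t + c < 1 + eps by have := bandP (repr (fiber b)); rewrite rE.
pose p : band := exist _ (phi (cinv (chart_at b) y), t + c) (mem_set btc).
have pE : fiber (cinv (chart_at b) y) = proj p.
  by apply/projP/(torus_relP fK gK epsP); exists phi, c.
have bp : box (repr (fiber b)) (val p).
  by rewrite /box rE; split=> //=; rewrite subrr normr0 invr_gt0.
have E := cmap_torus_chart sB fK gK epsP bp.
apply: (etrans _ (esym (etrans (congr1 (cmap (chart_at (fiber b))) pE) E))).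
by rewrite /tcoord rE /= /row_mxl add_row_mx addr0 add0r.
Qed.

Lemma fiber_smooth : smooth_map fiber.
Proof.
apply: (smooth_mapP sB sT fiber_continuous) => b.
have [phi [c [dc rE]]] := repr_fiber b.
apply: smooth_near_eq (fiber_near dc rE) _.
apply: smooth_nearD; last exact: smooth_near_cst.
apply: (smooth_near_linear_comp (L := @row_mxl R n 1)); first exact: linear_rV_continuous.
exact: (smooth_map_near_at sB sB _ (deck_smooth sB sf sg dc)).
Qed.

Lemma fiber_tangent b phi c (u : 'rV[R]_n) : deck phi c -> val (repr (fiber b)) = (phi b, t + c) ->
  u *m tangent_map fiber b = row_mx (u *m tangent_map phi b) 0.
Proof.
move=> dc rE; have nE := fiber_near dc rE.
have sphi := smooth_map_near_at sB sB b (deck_smooth sB sf sg dc).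
have dphi := smooth_near_differentiable sphi.
have dfib := smooth_near_differentiable (smooth_map_near_at sB sT b fiber_smooth).
apply: (etrans (esym (deriveEjacobian u dfib))).
apply: (etrans (esym (near_eq_derive u nE))).
have cL := @linear_rV_continuous R n _ (@row_mxl R n 1).
have dL x : differentiable (@row_mxl R n 1) x by exact: linear_differentiable.
have dLp := differentiable_comp dphi (dL _).
have H := deriveD (diff_derivable (v := u) dLp)
   (derivable_cst (row_mx 0 (const_mx (t + c)) : 'rV[R]_(n + 1)) _ u).
apply: (etrans H); rewrite derive_cst addr0.
apply: (etrans (derive_comp u dphi (dL _))); rewrite (derive_linear _ _ cL).
exact: (congr1 (fun x => row_mx x 0) (deriveEjacobian u dphi)).
Qed.

Lemma deck_tangent_inv phi c b : deck phi c -> exists T,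
  tangent_map phi b *m T = 1%:M /\ T *m tangent_map phi b = 1%:M.
Proof.
move=> dc; have [psi [dpsi phiK _]] := deck_inv fK gK dc.
have sphi := deck_smooth sB sf sg dc; have spsi := deck_smooth sB sf sg dpsi.
exists (tangent_map psi (phi b)).
have E : tangent_map phi b *m tangent_map psi (phi b) = 1%:M.
  apply: (etrans (esym (tangent_map_comp sB sB sB b sphi spsi))).
  have -> : psi \o phi = id by apply/funext.
  exact: tangent_map_id.
by split; [exact: E | exact: mulmx1C E].
Qed.

Lemma fiber_tangent_range b : range (fun u => u *m tangent_map fiber b) =
  characteristic_distribution (@torus_dt R n B f eps) (fiber b).
Proof.
rewrite (torus_dt_kernel sB sf sg fK gK epsP).
have [phi [c [dc rE]]] := repr_fiber b.
apply/seteqP; split=> [_ [u _ <-]|v /= v0].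
  by apply: (etrans (congr1 (fun x => rsubmx x 0 0) (fiber_tangent u dc rE))); rewrite row_mxKr mxE.
have [T [_ TK]] := deck_tangent_inv b dc.
exists (lsubmx v *m T) => //; apply: (etrans (fiber_tangent _ dc rE)).
apply: (etrans (congr1 (fun x => row_mx x 0) (etrans (esym (mulmxA _ _ _))
   (etrans (congr1 (mulmx (lsubmx v)) TK) (mulmx1 _))))).
rewrite -[RHS]hsubmxK; congr row_mx; apply/rowP => j; rewrite (ord1 j) v0 mxE //.
Qed.

Lemma fiber_immersion : immersion fiber.
Proof.
split; first exact: fiber_smooth.
move=> b; have [phi [c [dc rE]]] := repr_fiber b.
apply: inj_row_free => v vE.
have [T [TK _]] := deck_tangent_inv b dc.
have v0 : v *m tangent_map phi b = 0.
  have := etrans (esym (fiber_tangent v dc rE)) vE.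
  by move=> /(congr1 lsubmx); rewrite row_mxKl linear0.
have := congr1 (mulmx^~ T) v0.
by move=> /(etrans (mulmxA _ _ _)) /(etrans (esym (etrans (congr1 (mulmx v) TK) (mulmx1 v)))); rewrite mul0mx.
Qed.

(** V is the projection of U x ]t - 1/2, t + 1/2[: a point of level t identified with a
    point of that product is equal to it. *)
Lemma fiber_open_map (U : set B) : open U -> exists2 V : set torus, open V & fiber @^-1` V = U.
Proof.
move=> oU; pose W : set band := val @^-1` (fst @^-1` U `&` snd @^-1` [set s : R | `|s - t| < 2^-1]).
have oW : open W.
  exists (fst @^-1` U `&` snd @^-1` [set s : R | `|s - t| < 2^-1]) => //.
  apply: openI; apply: (continuousP _).1 => //.
  - by move=> p; exact: cvg_fst.
  - by move=> p; exact: cvg_snd.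
  - exact: open_ball_at.
exists (proj @` W); first exact: (torus_proj_open sB sf sg fK gK epsP oW).
apply/seteqP; split=> b.
  move=> [p [Up pt] /projP/(torus_relP fK gK epsP)[phi [c [dc]]]].
  rewrite val_band_pt => -[bE tE].
  have [phiE _] : phi = id /\ c = 0.
    by apply: (deck_norm dc); move: pt; rewrite /= tE !ltr_norml; lra.
  by rewrite bE phiE.
move=> Ub; exists (band_pt b) => //; split=> //=.
by rewrite subrr normr0 invr_gt0.
Qed.

Lemma fiber_embedding : embedding fiber.
Proof. by split; [exact: fiber_immersion | exact: fiber_inj | exact: fiber_open_map]. Qed.

Lemma pullback_fiber : pullback fiber (@torus_form R n B f eps w) = w.
Proof.
apply/funext => b; apply/funext => v.
have [phi [c [dc rE]]] := repr_fiber b.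
have pE := congr1 (fun W => W b v) (deck_pullback sB sf sg gK fw dc).
apply: (etrans _ pE); rewrite /pullback /torus_form rE.
apply: (congr1 (w (phi b))).
by apply: (etrans (congr1 lsubmx (fiber_tangent v dc rE))); rewrite row_mxKl.
Qed.

Lemma fiber_integral : connected [set: B] -> [set: B] !=set0 ->
  connected_integral_manifold (characteristic_distribution (@torus_dt R n B f eps)) fiber.
Proof.
move=> cB neB; split=> //; first exact: fiber_inj.
  exact: fiber_immersion.
exact: fiber_tangent_range.
Qed.

End fibers.

(** * Integral manifolds lie in fibers *)
Section leaves.
Context {R : realType} {n : nat} {B : charted R n}.
Variables (f g : B -> B) (eps : R).
Hypotheses (sB : smooth_manifold B) (sf : smooth_map f) (sg : smooth_map g).
Hypotheses (fK : cancel f g) (gK : cancel g f) (epsP : 0 < eps < 2^-1).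

Notation band := (@Defs.band R n B eps).
Notation torus := (mapping_torus f eps).
Notation proj := (@torus_proj R n B f eps).
Notation deck := (deck f g).

Let sT : smooth_manifold torus := smooth_mapping_torus sB sf sg fK gK epsP.

(** The coordinate t of q, defined modulo the deck transformations. *)
Definition on_level (t : R) (q : torus) : Prop :=
  exists2 p : band, q = proj p & (val p).2 = t.

Lemma on_level_transfer t t' q q' :
  on_level t q -> on_level t' q -> on_level t q' -> on_level t' q'.
Proof.
move=> [p -> pt] [p' pp' pt'] [s -> st].
move/projP/(torus_relP fK gK epsP): pp' => [phi [c [dc E]]].
have tE : t' = t + c by rewrite -pt' E pt.
have bs : - eps < (val s).2 + c < 1 + eps by rewrite st -tE -pt'; exact: bandP.
exists (exist _ (phi (val s).1, (val s).2 + c) (mem_set bs)); last by rewrite /= st tE.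
by apply/projP/(torus_relP fK gK epsP); exists phi, c.
Qed.

Lemma on_level_repr q : on_level (val (repr q)).2 q.
Proof. by exists (repr q) => //; exact/esym/(reprP (f := f)). Qed.

Section integral.
Context {m : nat} {L : charted R m} (i : L -> torus).
Hypothesis (iL : connected_integral_manifold
  (characteristic_distribution (@torus_dt R n B f eps)) i).

Let sL : smooth_manifold L. Proof. by case: iL. Qed.
Let si : smooth_map i. Proof. by case: iL => _ _ _ []. Qed.

Lemma integral_tangent x (u : 'rV[R]_m) : rsubmx (u *m tangent_map i x) 0 0 = 0.
Proof.
case: iL => _ _ _ _ /(_ x) E.
have : characteristic_distribution (@torus_dt R n B f eps) (i x) (u *m tangent_map i x).
  by rewrite -E; exists u.
by case.
Qed.

(** In the preferred chart at i x the coordinate t of i has zero derivative at all points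
    near x: transitions of the torus preserve the component along t, so it can be
    computed in the preferred chart at each image point, where tangent vectors of L
    are known to have no such component. *)
Lemma near_integral_level x : \forall x' \near x, on_level (val (repr (i x))).2 (i x').
Proof.
pose F := cmap (chart_at (i x)) \o i \o cinv (chart_at x).
have dx := cdom_chart_at sL x; have dix := cdom_chart_at sT (i x).
have nx : nbhs x (cdom (chart_at x) `&` i @^-1` cdom (chart_at (i x))).
  apply: filterI; first exact: (near_cdom (chart_at_axioms sL x)).
  by apply: (smooth_map_continuous si); exact: (near_cdom (chart_at_axioms sT (i x))).
have ny := near_cinv (chart_at_axioms sL x) dx nx.
have last_cst : \forall y \near cmap (chart_at x) x,
    (rsubmx (F y) 0 0 : R^o) = rsubmx (F (cmap (chart_at x) x)) 0 0.
  apply: (@near_derive0_cst R _ (fun y => rsubmx (F y) 0 0 : R^o)).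
  apply: filterS ny => y [iy [xy qy]].
  have yE := cinvK (chart_at_axioms sL x) iy.
  have sF := smooth_map_near sL sT si xy qy; rewrite yE in sF.
  have dF := smooth_near_differentiable sF.
  have cr : continuous (rsubmx : 'rV[R]_(n + 1) -> 'rV[R]_1) by exact: continuous_rsubmx.
  have dr : differentiable (rsubmx : 'rV[R]_(n + 1) -> 'rV[R]_1) (F y).
    exact: differentiable_rsubmx.
  have cc : continuous (@coordL R 1 0) by exact: coord_continuous.
  have dc : differentiable (@coordL R 1 0) (rsubmx (F y)) by exact: linear_differentiable.
  have drF := differentiable_comp dF dr.
  split; first exact: (differentiable_comp drF dc).
  move=> v; apply: (etrans (derive_comp v drF dc)).
  apply: (etrans (derive_linear _ _ cc)).
  apply: (etrans (congr1 (@coordL R 1 0) (derive_comp v dF dr))).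
  apply: (etrans (congr1 (@coordL R 1 0) (derive_linear _ _ cr))).
  apply: (etrans (congr1 (fun z => rsubmx z 0 0) (deriveEjacobian v dF))).
  have dy : tdom (repr (i x)) (F y).
    have := cimg_cmap qy; rewrite (cimg_torus_chart sB fK gK epsP).
    by [].
  have [phi [c [_ _ J]]] := torus_transition_jacobian sB sf sg fK gK epsP dy.
  have qE : cinv (torus_chart f (repr (i x))) (F y) = i (cinv (chart_at x) y).
    exact: (cmapK (chart_at_axioms sT (i x)) qy).
  rewrite qE in J.
  have T := jacobian_target_chart sL sT si xy qy.
  (* the transition to the preferred chart at the image point keeps the component along t *)
  have JF := congr1 (fun z => rsubmx z 0 0) (J (v *m jacobian F y)).
  rewrite row_mxKr in JF; apply: (etrans (esym JF)).
  rewrite yE in T.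
  have TT := etrans (esym (mulmxA v _ _)) (etrans (congr1 (mulmx v) T) (mulmxA v _ _)).
  apply: (etrans (congr1 (fun z => rsubmx z 0 0) TT)); exact: integral_tangent.
have := near_cmap (chart_at_axioms sL x) dx last_cst.
move=> /(filterI nx); apply: filterS => x' [[xx' qx'] [_ Fx']].
have : cdom (torus_chart f (repr (i x))) (i x') := qx'.
rewrite (cdom_torus_chartE f sB) => -[p bp pE]; exists p => //.
have FE : F (cmap (chart_at x) x') = tcoord (repr (i x)) (val p).
  rewrite /F /comp (cmapK (chart_at_axioms sL x) xx') -pE.
  exact: (cmap_torus_chart sB fK gK epsP bp).
have F0 : F (cmap (chart_at x) x) = tcoord (repr (i x)) (val (repr (i x))).
  rewrite /F /comp (cmapK (chart_at_axioms sL x) dx).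
  exact: (cmap_torus_self sB fK gK epsP).
have := etrans (esym (congr1 (fun z => rsubmx z 0 0) FE))
  (etrans Fx' (congr1 (fun z => rsubmx z 0 0) F0)).
by rewrite /tcoord !row_mxKr !mxE.
Qed.

(** The set of the points of a given level and its complement are both open. *)
Lemma integral_level x0 x : on_level (val (repr (i x0))).2 (i x).
Proof.
set t := (val (repr (i x0))).2.
pose A := [set x | on_level t (i x)].
have nearA x1 : A x1 -> nbhs x1 A.
  move=> Ax1; have := near_integral_level x1; apply: filterS => x' Hx'.
  exact: (on_level_transfer (on_level_repr (i x1)) Ax1 Hx').
have nearCA x1 : ~ A x1 -> nbhs x1 (~` A).
  move=> Ax1; have := near_integral_level x1; apply: filterS => x' Hx' Ax'; apply: Ax1.
  exact: (on_level_transfer Hx' Ax' (on_level_repr (i x1))).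
have [_ [_ cL] _ _ _] := iL.
have AT : A = setT.
  apply: cL; first by exists x0; exact: on_level_repr.
    by exists A; [rewrite openE => x1 /nearA | rewrite setTI].
  exists A; last by rewrite setTI.
  by rewrite -openC openE => x1 /nearCA.
have : [set: L] x by [].
by rewrite -AT.
Qed.

Variables (t : R) (bt : - eps < t < 1 + eps).
Notation fiber := (@fiber R n B f eps t bt).

(** The factorization p is continuous because fiber is a topological embedding.  It is
    smooth because in charts phi \o p is the component along B of i, for a deck
    transformation phi, whose inverse is smooth. *)
Lemma integral_factor : (forall x, on_level t (i x)) -> submanifold_le i fiber.
Proof.
move=> it; have /choice[p pE] : forall x, exists b, i x = fiber b.
  move=> x; have [p -> pt] := it x; exists (val p).1; congr (proj _).
  by apply: val_inj; rewrite val_band_pt -pt; case: (val p).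
exists p; last by apply/funext => x; rewrite /= pE.
have cp : continuous p.
  apply/continuousP => U /(fiber_open_map sB sf sg fK gK epsP bt)[V oV VU].
  rewrite (_ : p @^-1` U = i @^-1` V).
    by move: V oV {VU}; apply/continuousP; exact: smooth_map_continuous.
  by apply/seteqP; split=> x; rewrite -VU /= /preimage /= pE.
apply: (smooth_mapP sL sB cp) => x.
have [phi [c [dc rE]]] := repr_fiber fK gK epsP bt (p x).
rewrite -pE in rE.
have [psi [dpsi phiK psiK]] := deck_inv fK gK dc.
have sphi := deck_smooth sB sf sg dc; have spsi := deck_smooth sB sf sg dpsi.
have btc : - eps < t + c < 1 + eps by have := bandP (repr (i x)); rewrite rE.
have dx := cdom_chart_at sL x.
have Fs := smooth_map_near_at sL sT x si.
have nx : nbhs x (p @^-1` (phi @^-1` cdom (chart_at (phi (p x))))).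
  apply: cp; apply: (smooth_map_continuous sphi).
  by apply: (near_cdom (chart_at_axioms sB (phi (p x)))); exact: cdom_chart_at.
have lE x' : cdom (chart_at (phi (p x))) (phi (p x')) ->
    lsubmx (cmap (chart_at (i x)) (i x')) = cmap (chart_at (phi (p x))) (phi (p x')).
  move=> dphi; pose s : band := exist _ (phi (p x'), t + c) (mem_set btc).
  have sE : i x' = proj s.
    rewrite pE; apply/projP/(torus_relP fK gK epsP); exists phi, c; split=> //.
  have bs : box (repr (i x)) (val s).
    by rewrite /box rE; split=> //=; rewrite subrr normr0 invr_gt0.
  have E := cmap_torus_chart sB fK gK epsP bs.
  apply: (etrans (congr1 lsubmx (etrans (congr1 (cmap (chart_at (i x))) sE) E))).
  by rewrite /tcoord row_mxKl rE.
have Ex : lsubmx ((cmap (chart_at (i x)) \o i \o cinv (chart_at x)) (cmap (chart_at x) x))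
    = cmap (chart_at (phi (p x))) (phi (p x)).
  rewrite /comp (cmapK (chart_at_axioms sL x) dx) lE //; exact: cdom_chart_at.
apply: (@smooth_near_eq _ _ _
  ((cmap (chart_at (p x)) \o psi \o cinv (chart_at (phi (p x)))) \o
   (lsubmx \o (cmap (chart_at (i x)) \o i \o cinv (chart_at x))))).
  have := near_cinv (chart_at_axioms sL x) dx nx.
  apply: filterS => y [iy phiy].
  have E := lE _ phiy.
  apply: (etrans (congr1 (cmap (chart_at (p x)) \o psi \o cinv (chart_at (phi (p x)))) E)).
  by rewrite /comp (cmapK (chart_at_axioms sB _) phiy) phiK.
apply: smooth_near_comp.
  by apply: (smooth_near_linear_comp (L := lsubmx)) => //; exact: continuous_lsubmx.
rewrite /comp in Ex *; rewrite Ex.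
apply: (smooth_map_near sB sB spsi); first exact: cdom_chart_at.
by rewrite phiK; exact: cdom_chart_at.
Qed.

End integral.

End leaves.

Theorem theorem7p1 (R : realType) (h n : nat) (B : charted R n)
  (w : B -> kform R n 1) (f : B -> B) (eps : R)
  (contactB : contact_manifold h w)
  (connectedB : connected [set: B]) (compactB : compact [set: B])
  (diff_f : Diff_plus f) (fw : pullback f w = w)
  (eps_small : 0 < eps < 2^-1) :
  exists wt eta : mapping_torus f eps -> kform R (n + 1) 1,
    contact_pair h 0 wt eta /\
    forall (m : nat) (L : charted R m) (i : L -> mapping_torus f eps),
      leaf (characteristic_distribution eta) i ->
      exists2 g : B -> L,
        contactomorphism w (pullback i wt) g & embedding (i \o g).
Proof.
have [sB _ dw _] := contactB.
have [[sf [g sg [fK gK]]] _] := diff_f.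
exists (@torus_form R n B f eps w), (@torus_dt R n B f eps).
split; first exact: (contact_pair_torus sB sf sg fK gK eps_small dw fw contactB).
move=> m L i [iL maxi].
have [sL [[x0 _] _] i_inj [si _] _] := iL.
have bt : - eps < (val (repr (i x0))).2 < 1 + eps by exact: bandP.
have lev x := integral_level sB sf sg fK gK eps_small iL x0 x.
(* i factors through the fiber by p, hence, by maximality, the fiber through i by j *)
have [p sp pE] := integral_factor sB sf sg fK gK eps_small iL bt lev.
have fI := fiber_integral sB sf sg fK gK eps_small bt connectedB (ex_intro _ (p x0) I).
have [j sj jE] := maxi _ _ _ fI (ex_intro2 _ _ p sp pE).
have fiber_inj := fiber_inj fK gK eps_small (bt := bt).
exists j; last by rewrite jE; exact: (fiber_embedding sB sf sg fK gK eps_small bt).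
split.
  split=> //; exists p => //; split=> [b|x].
    by apply: fiber_inj; exact: etrans (congr1 (@^~ (j b)) pE) (congr1 (@^~ b) jE).
  by apply: i_inj; exact: etrans (congr1 (@^~ (p x)) jE) (congr1 (@^~ x) pE).
have sT := smooth_mapping_torus sB sf sg fK gK eps_small.
rewrite -[RHS](pullback_fiber sB sf sg fK gK eps_small fw bt) -jE.
apply/funext => b; apply/funext => v.
have T := tangent_map_comp sB sL sT b sj si.
exact: (congr1 (@torus_form R n B f eps w (i (j b)))
  (etrans (esym (mulmxA _ _ _)) (congr1 (mulmx v) (esym T)))).
Qed.
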